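(* Let $\nu$ be a Borel probability measure on $\Sigma$, and let $\{X_u:u\in\Lambda^*\}$ be nonnegative random variables on a probability space $(\Omega,\mathcal A,\mathbb P)$, with $X_\emptyset\equiv 1$, such that $\mathbb{E}(Y_{u_1\cdots u_{n+1}}\mid\mathcal F_n)=Y_{u_1\cdots u_n}$ for all $n\ge 1$ and all $u_1\cdots u_{n+1}\in\Lambda^{n+1}$, and $\mathbb E(X_j)=1$ for all $j\in\Lambda$. With $Z$, $L$, $S$, $\widetilde{\mathbb Q}$ and $\mathcal H_x$ as defined in the context, the following sufficient conditions for $Q$-singularity and $Q$-regularity hold. (i) If $\widetilde{\mathbb{Q}}(L=\infty)>0$, then $\mathbb{E}_{\mathbb{P}}(Z)<1$. If $\widetilde{\mathbb{Q}}(L=\infty)=1$, then $\mathbb{E}_{\mathbb{P}}(Z)=0$, i.e. $\nu$ is $Q$-singular. (ii) Suppose that the following property holds: for all $x\in\Sigma$, all $k\ge 0$ and all $u\in\Lambda^*\setminus\{\emptyset\}$ with $u_1\neq x_{k+1}$, one has $\mathbb{E}(Y_u^{[x|_k]}\mid\mathcal{H}_x)=1$ $\mathbb{P}$-almost surely. If $\widetilde{\mathbb{Q}}(S<\infty)>0$, then $\mathbb{E}_{\mathbb{P}}(Z)>0$, i.e. $Q\cdot\nu$ is non-degenerate. If $\widetilde{\mathbb{Q}}(S<\infty)=1$, then $\mathbb{E}_{\mathbb{P}}(Z)=1$, i.e. $\nu$ is $Q$-regular.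
   Context: Let $b\ge 2$ be an integer, $\Lambda=\{0,\ldots,b-1\}$, $\Lambda^*=\bigcup_{n\ge 0}\Lambda^n$ the set of finite words over $\Lambda$ (with $\Lambda^0=\{\emptyset\}$), $|u|$ the length of $u\in\Lambda^*$, and $\Sigma$ the one-sided symbolic space of infinite sequences $x=x_1x_2\cdots$ over $\Lambda$, with the metric $d(x,y)=e^{-\min\{n\ge1:\,x_n\ne y_n\}}$ and its Borel $\sigma$-field $\mathcal B$. Write $x|_0=\emptyset$, $x|_n=x_1\cdots x_n$ for $n\ge1$, and let $[u]$ be the cylinder of all $x\in\Sigma$ with prefix $u$. Given the probability space $(\Omega,\mathcal A,\mathbb P)$ and the nonnegative random variables $X_u$ on it, put $\mathcal F_n=\sigma\{X_u:|u|\le n\}$, and $\mathcal H_x=\sigma\{X_{x|_n}:n\ge1\}$ for $x\in\Sigma$. For $v\in\Lambda^*$, $n\ge1$ and $u=u_1\cdots u_n\in\Lambda^n$, put $Y^{[v]}_u=X_{vu_1}X_{vu_1u_2}\cdots X_{vu_1\cdots u_n}$; also $Y^{[v]}_\emptyset\equiv1$ and $Y_u=Y^{[\emptyset]}_u$. Let $(\widetilde\Omega,\widetilde{\mathcal A})=(\Omega\times\Sigma,\mathcal A\otimes\mathcal B)$. For $n\ge1$ put $W_n(\omega,x)=X_{x|_n}(\omega)$ and $Q_n=W_1W_2\cdots W_n$, so that $Q_n(\omega,x)=Y_{x|_n}(\omega)$. Let $\widetilde{\mathcal F}_n=\sigma\{W_1,\ldots,W_n\}$ and $\widetilde{\mathcal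 F}=\sigma(\bigcup_{n\ge 1}\widetilde{\mathcal F}_n)$. $\widetilde{\mathbb P}$ is the probability measure on $(\widetilde\Omega,\widetilde{\mathcal F})$ such that $\int_{\widetilde\Omega} f\,d\widetilde{\mathbb P}=\mathbb E_{\mathbb P}\int_\Sigma f(\cdot,x)\,\nu(dx)$ for $\widetilde{\mathcal F}$-measurable functions $f$. $\widetilde{\mathbb Q}$ is the probability measure on $(\widetilde\Omega,\widetilde{\mathcal F})$ such that $\int f\,d\widetilde{\mathbb Q}=\int f\,Q_n\,d\widetilde{\mathbb P}$ for every $n\ge1$ and $\widetilde{\mathcal F}_n$-measurable function $f$ (existence and uniqueness being granted by Kolmogorov's consistency theorem). Put $Z_n=\sum_{u\in\Lambda^n}Y_u\,\nu([u])$, the total mass of the random measure $\nu_n(dx)=Q_n(\cdot,x)\,\nu(dx)$, and define, for all $\omega\in\Omega$ and $x\in\Sigma$, $$Z(\omega)=\limsup_{n\to\infty}Z_n(\omega),\quad L(\omega,x)=\sup_{n\ge0}Y_{x|_n}(\omega)\nu([x|_n]),\quad S(\omega,x)=\sum_{k=0}^\infty Y_{x|_k}(\omega)\nu([x|_k]).$$ $(Z_n)_{n\ge1}$ is a nonnegative $\mathbb P$-martingale with respect to $(\mathcal F_n)$, of expectation $1$. Almost surely the measures $\nu_n$ converge weakly, as $n\to\infty$, to a random measure denoted $Q\cdot\nu$, whose total mass is almost surely $Z$. The measure $\nu$ is called $Q$-regular if $\mathbb E_{\mathbb P}(\|Q\cdot\nu\|)=1$ (where $\|\cdot\|$ is total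 mass; equivalently $(Z_n)$ is uniformly integrable), and $Q$-singular if $Q\cdot\nu=0$ almost surely. $Q\cdot\nu$ is non-degenerate if it is nonzero with positive probability.
   Formalization: The σ-fields F̃_n are taken as σ{W_1,…,W_n} with the coordinate x adjoined, and P̃, Q̃ live on the resulting larger field, since {L=∞} and {S<∞} involve ν([x|_n]) and need not lie in σ{W_n: n≥1} (e.g. X_u≡1). *)

(* Defs.v *)
From HB Require Import structures.
From mathcomp Require Import all_boot all_order all_algebra.
From mathcomp Require Import all_classical all_reals all_analysis.
From mathcomp Require Import measurable_realfun.
Import Order.TTheory GRing.Theory Num.Theory.
Import numFieldNormedType.Exports.

Set Implicit Arguments.
Unset Strict Implicit.
Unset Printing Implicit Defensive.

Local Open Scope classical_set_scope.
Local Open Scope ring_scope.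

(* The alphabet is 'I_b, finite words are sequences over 'I_b.  A point of the
   symbolic space is indexed from 0: [x n] is the letter written x_{n+1}.
   The bound on b (which makes the space inhabited) and the scalar field of the
   distance are parameters of the type, so that they can be inferred from it. *)
Definition symb (R : realType) (b : nat) (hb : (2 <= b)%N) : Type := nat -> 'I_b.

Section symbolic_space.
Variables (R : realType) (b : nat) (hb : (2 <= b)%N).
Local Notation Sigma := (symb R hb).

HB.instance Definition _ := gen_eqMixin Sigma.
HB.instance Definition _ := gen_choiceMixin Sigma.
HB.instance Definition _ :=
  isPointed.Build Sigma (fun=> Ordinal (ltnW hb)).

(* d(x, y) = exp(- min {n >= 1 : x_n <> y_n}), and 0 if x = y; the minimum is
   the successor of the first 0-based index at which x and y differ. *)
Definition sdist (x y : Sigma) : R :=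
  match pselect (exists n, x n != y n) with
  | left h => expR (- (ex_minn h).+1%:R)
  | right _ => 0
  end.

Lemma sdistxx x : sdist x x = 0.
Proof.
rewrite /sdist; case: pselect => // h; exfalso.
by case: h => n; rewrite eqxx.
Qed.

Lemma sdist_positivity x y : sdist x y = 0 -> x = y.
Proof.
rewrite /sdist; case: pselect => [h /eqP|h _]; first by rewrite gt_eqF ?expR_gt0.
apply/funext => n; apply/eqP; apply: contrapT => /negP xy.
by apply: h; exists n.
Qed.

Lemma sdist_sym x y : sdist x y = sdist y x.
Proof.
rewrite /sdist; case: pselect => [h|h]; case: pselect => [h'|h'] //.
- congr (expR (- _.+1%:R)); apply/eqP; rewrite eqn_leq.
  case: ex_minnP => m xm mmin; case: ex_minnP => k yk kmin.
  by rewrite mmin 1?eq_sym// kmin 1?eq_sym.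
- by exfalso; apply: h'; case: h => n xn; exists n; rewrite eq_sym.
- by exfalso; apply: h; case: h' => n xn; exists n; rewrite eq_sym.
Qed.

Lemma sdist_ge0 x y : 0 <= sdist x y.
Proof. by rewrite /sdist; case: pselect => // h; rewrite expR_ge0. Qed.

Lemma sdist_le x y n : x n != y n -> expR (- n.+1%:R) <= sdist x y.
Proof.
move=> xyn; rewrite /sdist; case: pselect => [h|h]; last first.
  by exfalso; apply: h; exists n.
rewrite ler_expR lerN2 ler_nat ltnS.
by case: ex_minnP => m _; apply.
Qed.

Lemma sdist_triangle y x z : sdist x z <= sdist x y + sdist y z.
Proof.
rewrite {1}/sdist; case: pselect => [h|_]; last by rewrite addr_ge0// sdist_ge0.
case: ex_minnP => n xzn _.
case: (eqVneq (x n) (y n)) => [xy|xy]; last first.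
  by apply: le_trans (sdist_le xy) _; rewrite lerDl sdist_ge0.
have yz : y n != z n by rewrite -xy.
by apply: le_trans (sdist_le yz) _; rewrite lerDr sdist_ge0.
Qed.

HB.instance Definition _ := @isMetric.Build R Sigma sdist
  sdistxx sdist_positivity sdist_sym sdist_triangle.

(* The Borel sigma-field of the metric topology. *)
Definition symb_borel : set (set Sigma) := <<s @open Sigma >>.

HB.instance Definition _ :=
  @isMeasurable.Build (sigma_display (@open Sigma)) Sigma symb_borel
    (@sigma_algebra0 _ setT (@open Sigma)) (@sigma_algebraC _ (@open Sigma))
    (@sigma_algebra_bigcup _ setT (@open Sigma)).

(* x|_n = x_1 ... x_n *)
Definition restr (x : Sigma) (n : nat) : seq 'I_b := mkseq x n.

Definition cyl (u : seq 'I_b) : set Sigma := [set x | restr x (size u) = u].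

End symbolic_space.

Section sub_sigma_fields.

(* <<s gen_by D f >> is the sigma-field generated by the f i for i in D. *)
Definition gen_by {I T : Type} d' (T' : measurableType d') (D : set I)
    (f : I -> T -> T') : set (set T) :=
  \bigcup_(i in D) preimage_set_system setT (f i) measurable.

Definition measurable_wrt {T : pointedType} d' {T' : measurableType d'}
    (G : set (set T)) (f : T -> T') : Prop :=
  measurable_fun (setT : set (g_sigma_algebraType G)) f.

(* g is a version of E(f | <<s G >>). *)
Definition is_cond_exp d (T : measurableType d) (R : realType)
    (P : probability T R) (G : set (set T)) (f g : T -> R) : Prop :=
  [/\ P.-integrable setT (EFin \o f),
      P.-integrable setT (EFin \o g),
      measurable_wrt G g &
      forall A, <<s G >> A ->
        (\int[P]_(w in A) (g w)%:E = \int[P]_(w in A) (f w)%:E)%E].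

End sub_sigma_fields.

Section multiplicative_chaos.
Local Open Scope ereal_scope.
Variables (R : realType) (b : nat) (hb : (2 <= b)%N).
Local Notation Sigma := (symb R hb).
Variables (d : measure_display) (Omega : measurableType d).
Variable X : seq 'I_b -> {mfun Omega >-> R}.

(* Y^{[v]}_u = X_{v u_1} X_{v u_1 u_2} ... X_{v u_1 ... u_n} *)
Definition Yprod (v u : seq 'I_b) (w : Omega) : R :=
  (\prod_(i < size u) X (v ++ take i.+1 u) w)%R.

Definition F_gen (n : nat) : set (set Omega) :=
  gen_by [set u : seq 'I_b | (size u <= n)%N] (fun u => X u : Omega -> R).

Definition H_gen (x : Sigma) : set (set Omega) :=
  gen_by [set n : nat | (1 <= n)%N] (fun n => X (restr x n) : Omega -> R).

Definition Wt (n : nat) (p : Omega * Sigma) : R := X (restr p.2 n) p.1.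

Definition Qprod (n : nat) (p : Omega * Sigma) : R :=
  (\prod_(1 <= k < n.+1) Wt k p)%R.

(* Ftilde_n = sigma{W_1, ..., W_n}, with the coordinate x itself adjoined.
   Since L and S involve nu([x|_k]), which in general is not a function of
   (W_k)_k, the events {L = oo} and {S < oo} need not belong to
   sigma{W_k : k >= 1}; with x adjoined they do.  The identities defining the
   two measures below are still consistent on these sigma-fields, because
   E(Y_{x|_{n+1}} | F_n) = Y_{x|_n} for each fixed x. *)
Definition Ft_gen (n : nat) : set (set (Omega * Sigma)) :=
  gen_by [set k : nat | (1 <= k <= n)%N] Wt
  `|` preimage_set_system setT snd measurable.

Definition Ft_gens : set (set (Omega * Sigma)) :=
  \bigcup_(n in [set n | (1 <= n)%N]) <<s Ft_gen n >>.

Definition Otilde : measurableType (sigma_display Ft_gens) :=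
  g_sigma_algebraType Ft_gens.

Variables (P : probability Omega R) (nu : probability Sigma R).

(* The defining identities are tested on nonnegative measurable functions,
   which determines the measures. *)
Definition is_Ptilde (Pt : probability Otilde R) : Prop :=
  forall f : Otilde -> \bar R, measurable_fun setT f -> (forall p, 0 <= f p) ->
    \int[Pt]_p f p = \int[P]_w \int[nu]_x f (w, x).

Definition is_Qtilde (Pt Qt : probability Otilde R) : Prop :=
  forall (n : nat) (f : Otilde -> \bar R), (1 <= n)%N ->
    measurable_wrt (Ft_gen n) f -> (forall p, 0 <= f p) ->
    \int[Qt]_p f p = \int[Pt]_p (f p * (Qprod n p)%:E).

Definition Zmass (n : nat) (w : Omega) : \bar R :=
  \sum_(u : n.-tuple 'I_b) (Yprod [::] u w)%:E * nu (cyl u).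

Definition Zlim (w : Omega) : \bar R := limn_esup (fun n => Zmass n w).

Definition Lsup (p : Omega * Sigma) : \bar R :=
  ereal_sup (range (fun n => (Yprod [::] (restr p.2 n) p.1)%:E
                             * nu (cyl (restr p.2 n)))).

Definition Ssum (p : Omega * Sigma) : \bar R :=
  \sum_(0 <= k <oo) (Yprod [::] (restr p.2 k) p.1)%:E
                     * nu (cyl (restr p.2 k)).

(* nu_n(dx) = Q_n(w, x) nu(dx) *)
Definition nu_ (n : nat) (w : Omega) (B : set Sigma) : \bar R :=
  \int[nu]_(x in B) (Qprod n (w, x))%:E.

(* Q.nu is almost surely the weak limit of the (finite) measures nu_ n. *)
Definition is_Qnu (Qnu : R.-ker Omega ~> Sigma) : Prop :=
  {ae P, forall w, Qnu w setT < +oo /\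
    forall f : Sigma -> R, continuous f ->
      (exists M : R, forall x, (`|f x| <= M)%R) ->
      \int[nu_ n w]_x (f x)%:E @[n --> \oo] --> \int[Qnu w]_x (f x)%:E}.

Definition Q_regular (Qnu : R.-ker Omega ~> Sigma) : Prop :=
  \int[P]_w Qnu w setT = 1.

Definition Q_singular (Qnu : R.-ker Omega ~> Sigma) : Prop :=
  {ae P, forall w, forall B, measurable B -> Qnu w B = 0}.

Definition Q_nondegenerate (Qnu : R.-ker Omega ~> Sigma) : Prop :=
  0 < P [set w | exists2 B, measurable B & Qnu w B != 0].

End multiplicative_chaos.

(* Main.v *)
Require Import Defs.
From HB Require Import structures.
From mathcomp Require Import all_boot all_order all_algebra.
From mathcomp Require Import all_classical all_reals all_analysis.
From mathcomp Require Import measurable_realfun.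
From mathcomp Require Import lra.
Import Order.TTheory GRing.Theory Num.Theory.
Import numFieldNormedType.Exports.
Local Open Scope classical_set_scope.
Local Open Scope ring_scope.
Local Open Scope ereal_scope.

(** Write Z_n for the total mass and Z for its limit, which exists almost surely
    because Z_n is a nonnegative martingale (Doob's upcrossing inequality).

    (i) Every term [Y_(x|n) nu([x|n])] of the supremum L is at most Z_n, and
    integrating over the cylinders of length n gives
      [Qt(max_(k <= n) Y_(x|k) nu([x|k]) > M) <= E(Z_n; max_(k <= n) Z_k > M)].
    As E(Z_n) = 1, Fatou's lemma (n to oo, then M to oo) yields
    [Qt(L = oo) + E(Z) <= 1].

    (ii) Under the size-biased measure the conditional mean of Z_n along a spine x
    is at most the partial sum S_n of S, so by Markov's inequality
      [Qt(S_n <= K) <= E(min(Z_n, M)) + K / M].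
    Letting n, then M, then K tend to infinity yields [Qt(S < oo) <= E(Z)].

    Working with these two inequalities avoids extending [Qt], which does not
    measure the variables off the spine, to a size-biased measure for Z_n. *)

Set Implicit Arguments.
Unset Strict Implicit.
Unset Printing Implicit Defensive.

(** * Measures with a density *)

Section density.
Context d (T : measurableType d) (R : realType).
Variables (mu : {measure set T -> \bar R}) (f : T -> R).
Hypotheses (mf : measurable_fun setT f) (f0 : forall x, (0 <= f x)%R).

(** The two proofs are arguments so that the measure structure declared below can be found from the
    term. *)
Definition mdensity of measurable_fun setT f & (forall x, 0 <= f x)%R :=
  fun A : set T => \int[mu]_(x in A) (f x)%:E.

Local Notation nu := (mdensity mf f0).

Let nu0 : nu set0 = 0.
Proof. exact: integral_set0. Qed.

Let nu_ge0 A : 0 <= nu A.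
Proof. by apply: integral_ge0 => x _; rewrite lee_fin. Qed.

Let nu_sigma_additive : semi_sigma_additive nu.
Proof.
move=> F mF tF mUF; rewrite /mdensity ge0_integral_bigcup//; last 2 first.
- exact/measurable_EFinP/measurable_funTS.
- by move=> x _; rewrite lee_fin.
by apply: is_cvg_ereal_nneg_natsum => n _; exact: nu_ge0.
Qed.

HB.instance Definition _ := isMeasure.Build _ _ _ nu
  nu0 nu_ge0 nu_sigma_additive.

Import HBNNSimple.

(** Linearity reduces simple functions to the indicators of their level sets; monotone convergence
    does the rest. *)
Lemma ge0_integral_mdensity (g : T -> \bar R) :
  measurable_fun setT g -> (forall x, 0 <= g x) ->
  \int[nu]_x g x = \int[mu]_x (g x * (f x)%:E).
Proof.
move=> mg g0.
pose h := nnsfun_approx measurableT mg.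
have cvgh x : (h n x)%:E @[n --> \oo] --> g x.
  exact: (cvg_nnsfun_approx measurableT mg (fun t _ => g0 t)).
have ndh x : nondecreasing_seq (fun n => (h n x)%:E).
  by move=> m n mn; rewrite lee_fin; exact/lefP/nd_nnsfun_approx.
have Hh n : \int[nu]_x (h n x)%:E = \int[mu]_x ((h n x)%:E * (f x)%:E).
  have mh r : measurable_fun setT (fun x => (r * \1_(h n @^-1` [set r]) x)%:E).
    exact/measurable_EFinP/measurable_funM.
  under [LHS]eq_integral do rewrite fimfunE -fsumEFin//.
  rewrite ge0_integral_fsum//; last first.
    by move=> r x _; rewrite nnfun_muleindic_ge0.
  under [RHS]eq_integral => x _.
    rewrite fimfunE -fsumEFin// ge0_mule_fsuml; last first.
      by move=> r; rewrite nnfun_muleindic_ge0.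
    over.
  rewrite ge0_integral_fsum//; last 2 first.
  - by move=> r; apply: emeasurable_funM => //; exact/measurable_EFinP.
  - by move=> r x _; rewrite mule_ge0// ?nnfun_muleindic_ge0 ?lee_fin.
  apply: eq_fsbigr => r; rewrite inE => -[x _ <-{r}].
  have mhx : measurable (h n @^-1` [set h n x]) by [].
  transitivity ((h n x)%:E * \int[mu]_(y in h n @^-1` [set h n x]) (f y)%:E).
    under eq_integral do rewrite EFinM.
    rewrite ge0_integralZl//; first by rewrite integral_indic// setIT.
    - exact/measurable_EFinP/measurable_indic.
    - by rewrite lee_fin.
  rewrite integral_mkcond -ge0_integralZl//; last 3 first.
  - apply/(measurable_restrictT _ _).1 => //; apply/measurable_funTS.
    exact/measurable_EFinP.
  - by move=> y _; rewrite /patch; case: ifPn => // _; rewrite lee_fin.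
  - by rewrite lee_fin.
  by apply: eq_integral => y _; rewrite epatch_indic /= EFinM -muleA [(f y)%:E * _]muleC.
transitivity (limn (fun n => \int[nu]_x (h n x)%:E)).
  rewrite -monotone_convergence//.
  - by apply: eq_integral => x _; apply/esym/cvg_lim.
  - by move=> n; exact/measurable_EFinP/measurable_funP.
  - by move=> n x _; rewrite lee_fin.
under eq_fun do rewrite Hh.
rewrite -monotone_convergence//.
- apply: eq_integral => x _; apply/cvg_lim => //.
  exact: cvgeZr.
- move=> n; apply: emeasurable_funM; exact/measurable_EFinP.
- by move=> n x _; rewrite mule_ge0// lee_fin.
- by move=> x _ m n mn; rewrite lee_wpmul2r ?lee_fin//; exact/lefP/nd_nnsfun_approx.
Qed.

End density.

(** * Integrals of functions measurable for a sub-sigma-field *)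

Section sub_sigma_field.
Context d (T : measurableType d) (R : realType).
Variable mu : {measure set T -> \bar R}.

(** The measures with densities [f] and [f'] agree on [<<s G >>], hence give the same integral to
    every nonnegative function measurable for it. This serves to pull a factor out of a conditional
    expectation. *)
Lemma ge0_integral_mul_sub_sigma (G : set (set T)) (f f' : T -> R)
    (g : T -> \bar R) :
  <<s G >> `<=` measurable ->
  measurable_fun setT f -> (forall x, (0 <= f x)%R) ->
  measurable_fun setT f' -> (forall x, (0 <= f' x)%R) ->
  (forall A, <<s G >> A ->
    \int[mu]_(x in A) (f x)%:E = \int[mu]_(x in A) (f' x)%:E) ->
  measurable_wrt G g -> (forall x, 0 <= g x) ->
  \int[mu]_x (g x * (f x)%:E) = \int[mu]_x (g x * (f' x)%:E).
Proof.
move=> Gm mf f0 mf' f'0 ff' mg g0.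
(* Pushing a measure forward along the identity into the coarser space restricts it to
   [<<s G >>]. *)
pose idG : T -> g_sigma_algebraType G := id.
have midG : measurable_fun setT idG.
  by move=> _ B mB; rewrite setTI; exact: Gm.
have mg' : measurable_fun setT (g : T -> _).
  by have := measurableT_comp mg midG.
rewrite -(ge0_integral_mdensity mu mf f0 mg' g0).
rewrite -(ge0_integral_mdensity mu mf' f'0 mg' g0).
have pushE (nu : {measure set T -> \bar R}) :
    \int[nu]_x g x = \int[pushforward nu idG]_x g x.
  exact: (esym (ge0_integral_pushforward midG nu measurableT mg (fun x _ => g0 x))).
rewrite !pushE; apply: eq_measure_integral => A mA _.
exact: ff'.
Qed.

End sub_sigma_field.

(** * Upcrossings of a real sequence *)

Section upcrossings.
Context (R : realType) (a b : R).
Implicit Types u : nat -> R.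

(* Buy when the price is below [a], sell once it is above [b]: [holding u n]
   tells whether the stock is held between the times [n.-1] and [n]. *)
Fixpoint holding u n : bool :=
  if n is m.+1 then (if holding u m then (u m <= b)%R else (u m < a)%R)
  else false.

Fixpoint upcrossings u n : nat :=
  if n is m.+1 then (upcrossings u m + (holding u m && (b < u m)%R))%N else 0%N.

(** After any time a price below [a] ensures that the stock is held at some moment, and a held stock
    is sold at the latest at the next price above [b]; so the number of sales can always be
    raised. *)
Lemma upcrossings_unbounded u :
  (forall n, exists2 m, (n <= m)%N & (u m < a)%R) ->
  (forall n, exists2 m, (n <= m)%N & (b < u m)%R) ->
  forall k, exists n, (k <= upcrossings u n)%N.
Proof.
move=> ua ub.
have hold n : exists2 m, (n <= m)%N & holding u m.
  have [m nm uma] := ua n; case: (boolP (holding u m)) => hm; first by exists m.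
  by exists m.+1; [exact: leqW|rewrite /= (negbTE hm)].
have up n : holding u n -> exists m, (upcrossings u n < upcrossings u m)%N.
  (* Induction on the waiting time [k] until a price above [b]. *)
  have [m nm] := ub n; rewrite -(subnKC nm); move: (m - n)%N => {nm m}k.
  elim: k n => [|k IH] n.
    by rewrite addn0 => ubn hn; exists n.+1; rewrite /= hn ubn addn1.
  rewrite addnS -addSn => ubn hn.
  have [ubn'|unb] := ltP b (u n); first by exists n.+1; rewrite /= hn ubn' addn1.
  have [|m' hm'] := IH n.+1 ubn; first by rewrite /= hn.
  exists m'; apply: leq_ltn_trans hm'; exact: leq_addr.
elim=> [|k [n kn]]; first by exists 0%N.
have [m nm hm] := hold n; have [p mp] := up _ hm.
exists p; apply: leq_ltn_trans mp; apply: leq_trans kn _.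
elim: m nm {hm} => [|m IH]; first by rewrite leqn0 => /eqP ->.
rewrite leq_eqVlt => /orP[/eqP->//|]; rewrite ltnS => /IH /leq_trans; apply.
exact: leq_addr.
Qed.

Lemma upcrossings_nd u : nondecreasing_seq (upcrossings u).
Proof. by apply/nondecreasing_seqP => n; exact: leq_addr. Qed.

(* Up to the constant [a], a lower bound for the profit of this strategy; along
   a martingale its expectation does not increase. *)
Definition upcrossing_gain u n : R :=
  (b - a) * (upcrossings u n)%:R + (holding u n)%:R * (u n - a) + a.

(** The gain books purchases at [a] and sales at [b], while the strategy buys cheaper and sells
    dearer; so it grows by at most [u n.+1 - u n] when the stock is held, and by at most 0
    otherwise. Avoiding differences leaves only nonnegative functions to integrate later. *)
Lemma upcrossing_gain_step u n : (0 <= a)%R -> (a < b)%R ->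
  (upcrossing_gain u n.+1 + (holding u n.+1)%:R * u n <=
   upcrossing_gain u n + (holding u n.+1)%:R * u n.+1)%R.
Proof.
move=> a0 ab; rewrite /upcrossing_gain /=; case: ifPn => hn /=.
  case: leP => unb /=; rewrite ?addn0 ?natrD; nra.
by case: ltP => una; rewrite /= ?addn0; nra.
Qed.

(** An open position loses at most [a], prices being nonnegative; the constant in the gain covers
    this. *)
Lemma upcrossing_gain_ge u n : (0 <= a)%R -> (a < b)%R -> (0 <= u n)%R ->
  ((b - a) * (upcrossings u n)%:R <= upcrossing_gain u n)%R.
Proof.
by move=> a0 ab un0; rewrite /upcrossing_gain; case: holding => /=; lra.
Qed.

End upcrossings.

(** * Lower and upper limits in the extended reals *)

Section limn_einf_esup.
Context (R : realType).
Implicit Types (u : (\bar R)^nat) (x : \bar R).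

Lemma limn_einf_lt_frequently u x : limn_einf u < x ->
  forall n, exists2 m, (n <= m)%N & u m < x.
Proof.
rewrite limn_einf_lim (cvg_lim _ (ereal_nondecreasing_cvgn (nondecreasing_einfs u)))//.
move=> ux n; have /ereal_inf_lt[_ [m /= nm <-] umx] : einfs u n < x.
  by apply: le_lt_trans ux; apply: ereal_sup_ubound; exists n.
by exists m.
Qed.

Lemma limn_esup_gt_frequently u x : x < limn_esup u ->
  forall n, exists2 m, (n <= m)%N & x < u m.
Proof.
rewrite -lteN2 -limn_einfN => /limn_einf_lt_frequently + n => /(_ n)[m nm].
by rewrite /= lteN2; exists m.
Qed.

(** Rational levels leave only countably many null sets to discard in the convergence theorem. *)
Lemma rat_in_between x y : 0 <= x -> x < y ->
  exists q r : rat, [/\ (0 <= ratr q :> R)%R, (ratr q < ratr r :> R)%R,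
    x < (ratr q)%:E & (ratr r)%:E < y].
Proof.
case: x => [x| |]//; rewrite ?lee_fin => x0 xy; last by move: xy; rewrite ltNge leey.
(* A real upper end for the choice of rationals: [y] may be [+oo], and then [x + 1] serves. *)
have [z xz zy] : exists2 z : R, (x < z)%R & z%:E <= y.
  case: y xy => [y| |]//; first by rewrite lte_fin => xy; exists y.
  by exists (x + 1)%R; rewrite ?ltrDl// leey.
have [q] := rat_in_itvoo xz; rewrite in_itv/= => /andP[xq qz].
have [r] := rat_in_itvoo qz; rewrite in_itv/= => /andP[qr rz].
exists q, r; split => //; first exact: le_trans (ltW xq).
by apply: lt_le_trans zy; rewrite lte_fin.
Qed.

End limn_einf_esup.

(** * Almost sure convergence of nonnegative martingales *)

Section martingale_convergence.
Context d (T : measurableType d) (R : realType) (P : probability T R).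
Variables (G : nat -> set (set T)) (M : nat -> T -> R).
Hypothesis Gm : forall n, <<s G n >> `<=` measurable.
Hypothesis GS : forall n, <<s G n >> `<=` <<s G n.+1 >>.
Hypothesis M0 : forall n w, (0 <= M n w)%R.
Hypothesis adapted : forall n, measurable_wrt (G n) (M n).
Hypothesis integrableM : forall n, \int[P]_w (M n w)%:E < +oo.
Hypothesis martingale : forall n A, <<s G n >> A ->
  \int[P]_(w in A) (M n.+1 w)%:E = \int[P]_(w in A) (M n w)%:E.

Section upcrossing_bound.
Variables (a b : R) (a0 : (0 <= a)%R) (ab : (a < b)%R).

Let path w n := M n w.

Let mM n : measurable_fun setT (M n).
Proof.
move=> _ B mB; rewrite setTI; apply: Gm.
by rewrite -[X in <<s _ >> X]setTI; exact: adapted.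
Qed.

Let hold_set n := [set w | holding a b (path w) n].

(** The decision for the period from [n] to [n.+1] depends on the values up to time [n] only; this
    lets the martingale identity be applied on the event. *)
Let hold_predictable n : <<s G n >> (hold_set n.+1).
Proof.
have mG (B : set R) m : measurable B -> <<s G m >> (M m @^-1` B).
  by move=> mB; rewrite -[X in <<s _ >> X]setTI; exact: adapted.
have step m : hold_set m.+1 =
    (hold_set m `&` M m @^-1` `]-oo, b]) `|` (~` hold_set m `&` M m @^-1` `]-oo, a[).
  apply/seteqP; split => w; rewrite /hold_set/= /path !in_itv/=.
    by case: ifPn => hw; [left|right].
  by move=> [[-> //]|[/negP/negbTE -> //]].
have mI m : (forall A B, <<s G m >> A -> <<s G m >> B -> <<s G m >> (A `&` B)).
  move=> A B; exact: (@measurableI _ (g_sigma_algebraType (G m))).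
have mU m : (forall A B, <<s G m >> A -> <<s G m >> B -> <<s G m >> (A `|` B)).
  move=> A B; exact: (@measurableU _ (g_sigma_algebraType (G m))).
have mC m : (forall A, <<s G m >> A -> <<s G m >> (~` A)).
  move=> A; exact: (@measurableC _ (g_sigma_algebraType (G m))).
have hold_set0 : <<s G 0%N >> (hold_set 0).
  rewrite (_ : hold_set 0 = set0); last by apply/seteqP; split.
  exact: (@measurable0 _ (g_sigma_algebraType (G 0%N))).
have Hstep m : <<s G m >> (hold_set m) -> <<s G m >> (hold_set m.+1).
  by move=> Hm; rewrite step; apply: mU; apply: mI; try exact: mC; auto; apply: mG.
by elim: n => [|n IH]; apply: Hstep => //; exact: GS.
Qed.

Let mhold n : measurable (hold_set n).
Proof.
case: n => [|n]; last by apply: (Gm (n := n)); exact: hold_predictable.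
by rewrite (_ : hold_set 0 = set0)//; apply/seteqP; split.
Qed.

Let mholdr n : measurable_fun setT (fun w => (holding a b (path w) n)%:R : R).
Proof.
rewrite (_ : (fun _ => _) = \1_(hold_set n)); first exact: measurable_indic.
by apply/funext => w; rewrite indicE mem_setE.
Qed.

Let mup n : measurable_fun setT (fun w => (upcrossings a b (path w) n)%:R : R).
Proof.
elim: n => [|n IH] /=; first exact: measurable_cst.
under eq_fun do rewrite natrD.
apply: measurable_funD => //.
rewrite (_ : (fun _ => _) = \1_(hold_set n `&` M n @^-1` `]b, +oo[)); last first.
  apply/funext => w; rewrite indicE in_setI mem_setE; congr (nat_of_bool (_ && _))%:R.
  by apply/idP/idP; rewrite inE /= in_itv/= andbT.
apply: measurable_indic; apply: measurableI => //.
by rewrite -[X in measurable X]setTI; exact: mM.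
Qed.

Let gain n w := upcrossing_gain a b (path w) n.

Let mgain n : measurable_fun setT (gain n).
Proof.
apply: measurable_funD => //; apply: measurable_funD; apply: measurable_funM => //.
exact: (measurable_funB (mM n) (measurable_cst _)).
Qed.

Let up_ge0 n w : (0 <= (b - a) * (upcrossings a b (path w) n)%:R)%R.
Proof. by rewrite mulr_ge0// subr_ge0 ltW. Qed.

Let gain_ge0 n w : (0 <= gain n w)%R.
Proof. by apply: le_trans (upcrossing_gain_ge _ _ _) => //; exact: M0. Qed.

(** The gain starts at [a], and its increment is at most [H * (M n.+1 - M n)] with [H] the indicator
    of a predictable event, which has mean 0 by the martingale identity. *)
Let integral_gain n : \int[P]_w (gain n w)%:E <= a%:E.
Proof.
elim: n => [|n IH].
  under eq_integral do rewrite /gain /upcrossing_gain /= mulr0 mul0r !add0r.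
  by rewrite integral_cst//= probability_setT mule1.
apply: le_trans IH; pose H w : R := (holding a b (path w) n.+1)%:R.
have HM k : \int[P]_w (H w * M k w)%:E = \int[P]_(w in hold_set n.+1) (M k w)%:E.
  rewrite [RHS]integral_mkcond; apply: eq_integral => w _.
  rewrite epatch_indic /= indicE mem_setE muleC -EFinM; congr (_ * _)%:E.
have finHM : \int[P]_w (H w * M n w)%:E \is a fin_num.
  rewrite ge0_fin_numE; last first.
    by apply: integral_ge0 => w _; rewrite lee_fin mulr_ge0// ler0n.
  apply: le_lt_trans (integrableM n); apply: ge0_le_integral => //.
  - by move=> w _; rewrite lee_fin mulr_ge0// ler0n.
  - by apply/measurable_EFinP/measurable_funM => //; exact: mholdr.
  - exact/measurable_EFinP.
  - by move=> w _; rewrite lee_fin /H; case: holding; rewrite ?mul1r ?mul0r.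
(* The finite integral of [H * M n] is added to both sides, so that no difference has to be
   integrated. *)
rewrite -(leeD2rE _ _ finHM).
have -> : \int[P]_w (gain n w)%:E + \int[P]_w (H w * M n w)%:E =
    \int[P]_w (gain n w)%:E + \int[P]_w (H w * M n.+1 w)%:E.
  by rewrite !HM martingale.
have mHM k : measurable_fun setT (fun w => (H w * M k w)%:E).
  by apply/measurable_EFinP/measurable_funM => //; exact: mholdr.
have HM0 k w : 0 <= (H w * M k w)%:E.
  by rewrite lee_fin mulr_ge0// ler0n.
have mg k : measurable_fun setT (fun w => (gain k w)%:E) by exact/measurable_EFinP.
have g0 k w : 0 <= (gain k w)%:E by rewrite lee_fin.
rewrite -!ge0_integralD//; apply: ge0_le_integral => //.
- by move=> w _; rewrite adde_ge0.
- exact: emeasurable_funD.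
- exact: emeasurable_funD.
- by move=> w _; rewrite -!EFinD lee_fin; exact: upcrossing_gain_step.
Qed.

(** By monotone convergence the total number of upcrossings has mean at most [a / (b - a)], so it is
    almost surely finite. *)
Lemma ae_upcrossings_bounded :
  {ae P, forall w, exists k, forall n, (upcrossings a b (M ^~ w) n < k)%N}.
Proof.
pose c n w := ((b - a) * (upcrossings a b (path w) n)%:R)%:E.
have ndc w : nondecreasing_seq (c ^~ w).
  move=> m n mn; rewrite lee_fin; apply: ler_wpM2l; first by rewrite subr_ge0 ltW.
  by rewrite ler_nat; exact: upcrossings_nd.
have mc n : measurable_fun setT (c n).
  by apply/measurable_EFinP/measurable_funM.
have mlimc : measurable_fun setT (fun w => limn (c ^~ w)).
  apply: (emeasurable_fun_cvg c) => // w _.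
  exact: ereal_nondecreasing_is_cvgn.
have limc0 w : 0 <= limn (c ^~ w).
  apply: lime_ge; first exact: ereal_nondecreasing_is_cvgn.
  by apply: nearW => n; rewrite lee_fin.
have intc : P.-integrable setT (fun w => limn (c ^~ w)).
  apply/integrableP; split => //.
  under eq_integral do rewrite gee0_abs//.
  rewrite monotone_convergence//; last by move=> n w _; rewrite lee_fin.
  apply: (@le_lt_trans _ _ a%:E); last exact: ltry.
  apply: lime_le.
    apply: ereal_nondecreasing_is_cvgn => m n mn; apply: ge0_le_integral => //.
    + by move=> w _; rewrite lee_fin.
    + by move=> w _; exact: ndc.
  apply: nearW => n; apply: le_trans (integral_gain n); apply: ge0_le_integral => //.
  - by move=> w _; rewrite lee_fin.
  - exact/measurable_EFinP.
  - by move=> w _; rewrite lee_fin; apply: upcrossing_gain_ge => //; exact: M0.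
have := integrable_ae measurableT intc; apply: filterS => w /(_ I) fin.
pose K := (fine (limn (c ^~ w)) / (b - a))%R.
exists (Num.truncn K).+1 => n.
have K0 : (0 <= K)%R by rewrite divr_ge0 ?fine_ge0// subr_ge0 ltW.
rewrite -(ltr_nat R); apply: le_lt_trans (truncnS_gt _).
rewrite ler_pdivlMr ?subr_gt0// mulrC -lee_fin fineK//.
have cw : c n w <= limn (c ^~ w).
  apply: lime_ge; first exact: ereal_nondecreasing_is_cvgn.
  by near=> m; apply: ndc; near: m; exists n.
exact: cw.
Unshelve. all: by end_near. Qed.

End upcrossing_bound.

(** If the lower limit were less than the upper one, two rationals in between would be crossed
    infinitely often, which is excluded almost surely for all pairs at once. *)
Lemma martingale_convergence :
  {ae P, forall w, limn_einf (fun n => (M n w)%:E) = limn_esup (fun n => (M n w)%:E)}.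
Proof.
(* Pairs of rationals are enumerated through [unpickle], so that a countable intersection of almost
   sure events suffices. *)
have : {ae P, forall w, forall n, if (unpickle n : option (rat * rat)) is Some (q, r)
    then (0 <= ratr q :> R)%R -> (ratr q < ratr r :> R)%R ->
      exists k, forall n, (upcrossings (ratr q) (ratr r) (M ^~ w) n < k)%N
    else True}.
  apply: ae_foralln => n; case: (unpickle n : option _) => [[q r]|]; last exact: aeW.
  have [q0|q0] := boolP (0 <= ratr q :> R)%R; last by apply: aeW.
  have [qr|qr] := boolP (ratr q < ratr r :> R)%R; last first.
    by apply: aeW.
  by have := ae_upcrossings_bounded q0 qr; apply: filterS.
apply: filterS => w bounded; apply/eqP; rewrite eq_le limn_einf_sup leNgt.
apply/negP => infsup.
have [|q [r [q0 qr infq rsup]]] := rat_in_between _ infsup.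
  rewrite limn_einf_lim; apply: lime_ge; first exact: is_cvg_einfs.
  by apply: nearW => n; apply: le_ereal_inf_tmp => _ [m _ <-]; rewrite lee_fin.
have := bounded (pickle (q, r)); rewrite pickleK => /(_ q0 qr)[k upk].
have [||n] := @upcrossings_unbounded R (ratr q) (ratr r) (M ^~ w) _ _ k.
- by move=> n; have [m nm] := limn_einf_lt_frequently infq n; exists m.
- by move=> n; have [m nm] := limn_esup_gt_frequently rsup n; exists m.
by rewrite leqNgt upk.
Qed.

End martingale_convergence.

(** * Cylinders and functions of a finite prefix *)

Section cylinders.
Context (R : realType) (b : nat) (hb : (2 <= b)%N).
Local Notation Sigma := (symb R hb).
Implicit Types (x y : Sigma) (u v : seq 'I_b).

Lemma size_restr x n : size (restr x n) = n.
Proof. exact: size_mkseq. Qed.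

Lemma take_restr x k n : (k <= n)%N -> take k (restr x n) = restr x k.
Proof. by move=> kn; rewrite /restr /mkseq -map_take take_iota (minn_idPl kn). Qed.

(** Padding with the letter 0 provides a spine through [u]. *)
Definition extend u : Sigma := fun n => nth (Ordinal (ltnW hb)) u n.

Lemma restr_extend u : restr (extend u) (size u) = u.
Proof. exact: mkseq_nth. Qed.

Lemma open_cyl u : open (cyl u : set Sigma).
Proof.
(* The radius is exp(-|u|): two points that differ at a 0-based index [i < size u] are at distance
   at least exp(-(i+1)), hence at least this radius. *)
rewrite openE => x xu; apply/nbhs_ballP; exists (expR (- (size u)%:R)) => /=.
  exact: expR_gt0.
move=> y; rewrite ballEmdist/= => xy; rewrite /cyl/= -xu size_restr.
apply/eq_in_map => i; rewrite mem_iota /= add0n => iu.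
apply/esym/eqP; apply: contraTT xy => xyi; rewrite -leNgt.
apply: (@le_trans _ _ (expR (- i.+1%:R))); last exact: sdist_le.
by rewrite ler_expR lerN2 ler_nat.
Qed.

Lemma measurable_cyl u : measurable (cyl u : set Sigma).
Proof. by apply: sub_sigma_algebra; exact: open_cyl. Qed.

Lemma measurable_restr n (A : set (seq 'I_b)) :
  measurable [set x : Sigma | A (restr x n)].
Proof.
rewrite [X in measurable X](_ : _ =
    \bigcup_(u in [set u : n.-tuple 'I_b | A u]) cyl u).
  by apply: fin_bigcup_measurable => // u _; exact: measurable_cyl.
apply/seteqP; split => [x Ax|x [u /= Au]].
  have xn : size (restr x n) == n by rewrite size_restr.
  by exists (Tuple xn) => //; rewrite /cyl /= size_restr.
by rewrite /cyl/= size_tuple => ->.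
Qed.

Lemma measurable_fun_restr d' (U : measurableType d') n (g : seq 'I_b -> U) :
  measurable_fun setT (fun x : Sigma => g (restr x n)).
Proof.
move=> _ B mB; rewrite setTI.
exact: (measurable_restr n (fun u => B (g u))).
Qed.

Lemma sum_indic_cyl n (g : seq 'I_b -> \bar R) x :
  g (restr x n) = \sum_(u : n.-tuple 'I_b) g u * (\1_(cyl u : set Sigma) x)%:E.
Proof.
have xn : size (restr x n) == n by rewrite size_restr.
rewrite (bigD1 (Tuple xn))//= big1 => [|u ux].
  rewrite adde0 indicE mem_set ?mule1//=.
  by rewrite /cyl /= size_restr.
rewrite indicE memNset ?mule0// /cyl /= size_tuple => xu.
by move/eqP: ux; apply; exact/val_inj.
Qed.

(** The integrand is constant on each of the finitely many cylinders of length [n]. *)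
Lemma integral_restr (nu : {measure set Sigma -> \bar R}) n
    (g : seq 'I_b -> \bar R) : (forall u, 0 <= g u) ->
  \int[nu]_x g (restr x n) = \sum_(u : n.-tuple 'I_b) g u * nu (cyl u).
Proof.
move=> g0; under eq_integral do rewrite sum_indic_cyl.
rewrite ge0_integral_sum//; last 2 first.
- move=> u; apply: emeasurable_funM; first exact: measurable_cst.
  by apply/measurable_EFinP; apply: measurable_indic; exact: measurable_cyl.
- by move=> u x _; rewrite mule_ge0// lee_fin.
apply: eq_bigr => u _; rewrite ge0_integralZl//.
- by rewrite integral_indic ?setIT//; exact: measurable_cyl.
- by apply/measurable_EFinP; apply: measurable_indic; exact: measurable_cyl.
Qed.

(** Both sums are the integral of [g (restr x n)]. *)
Lemma sum_cyl_take (nu : {measure set Sigma -> \bar R}) n m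
    (g : seq 'I_b -> \bar R) : (n <= m)%N -> (forall u, 0 <= g u) ->
  \sum_(v : m.-tuple 'I_b) g (take n v) * nu (cyl v) =
  \sum_(u : n.-tuple 'I_b) g u * nu (cyl u).
Proof.
move=> nm g0; rewrite -(integral_restr nu m (g := fun v => g (take n v)))//.
by rewrite -integral_restr//; under eq_integral do rewrite take_restr//.
Qed.

(** This is [sum_cyl_take] with [g] the indicator of the word [u]. *)
Lemma sum_cyl_prefix (nu : {measure set Sigma -> \bar R}) n u :
  (size u <= n)%N ->
  \sum_(v : n.-tuple 'I_b | take (size u) v == u) nu (cyl v) = nu (cyl u).
Proof.
move=> un; rewrite big_mkcond /=.
pose g v : \bar R := ((v == u)%:R)%:E.
have g0 v : 0 <= g v by rewrite lee_fin.
transitivity (\sum_(v : n.-tuple 'I_b) g (take (size u) v) * nu (cyl v)).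
  by apply: eq_bigr => v _; rewrite /g; case: eqP; rewrite ?mul1e ?mul0e.
rewrite sum_cyl_take// (bigD1 (in_tuple u))//= /g eqxx mul1e big1 ?adde0// => v.
by rewrite -val_eqE /= => /negbTE ->; rewrite mul0e.
Qed.

Lemma sum_cyl (nu : {measure set Sigma -> \bar R}) n :
  \sum_(u : n.-tuple 'I_b) nu (cyl u) = nu setT.
Proof.
rewrite -[RHS]mul1e -(integral_cst nu measurableT 1%:E).
rewrite (integral_restr nu n (g := cst 1))//.
by apply: eq_bigr => u _; rewrite mul1e.
Qed.

End cylinders.

(** * Shifted limits and generated sigma-fields *)

Lemma limn_esup_shiftS (R : realType) (u : (\bar R)^nat) :
  limn_esup (fun n => u n.+1) = limn_esup u.
Proof.
rewrite !limn_esup_lim; apply/cvg_lim => //.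
rewrite (_ : esups _ = (fun n => esups u n.+1)); first by
  rewrite (cvg_shiftS (esups u)); exact: is_cvg_esups.
apply/funext => n; congr ereal_sup; apply/seteqP; split => _ [k /= nk <-].
  by exists k.+1.
by case: k nk => // k nk; exists k.
Qed.

Lemma limn_einf_shiftS (R : realType) (u : (\bar R)^nat) :
  limn_einf (fun n => u n.+1) = limn_einf u.
Proof. by congr (- _); exact: limn_esup_shiftS. Qed.

Lemma cvg_limn_einf_esup (R : realType) (u : (\bar R)^nat) :
  limn_einf u = limn_esup u -> u @ \oo --> limn_esup u.
Proof.
move=> infsup; apply: (@squeeze_cvge _ _ _ _ (einfs u) _ (esups u)).
- apply: nearW => n; apply/andP; split; first by apply: ereal_inf_lbound; exists n => /=.
  by apply: ereal_sup_ubound; exists n => /=.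
- by rewrite -infsup limn_einf_lim; exact: is_cvg_einfs.
- by rewrite limn_esup_lim; exact: is_cvg_esups.
Qed.

Lemma sub_gen_by {I T : Type} d' (T' : measurableType d') (D : set I)
    (f : I -> T -> T') (i : I) (B : set T') :
  D i -> measurable B -> <<s gen_by D f >> (f i @^-1` B).
Proof.
move=> Di mB; apply: sub_sigma_algebra; exists i => //.
by exists B => //; rewrite setTI.
Qed.

Lemma gen_by_measurable {I : Type} d (T : measurableType d) d'
    (T' : measurableType d') (D : set I) (f : I -> T -> T') :
  (forall i, D i -> measurable_fun setT (f i)) ->
  <<s gen_by D f >> `<=` measurable.
Proof.
move=> mf; apply: smallest_sub; first exact: sigma_algebra_measurable.
by move=> _ [i Di [B mB <-]]; exact: mf.
Qed.

Lemma measurable_wrt_gen_by {I : Type} (T : pointedType) d'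
    (T' : measurableType d') (D : set I) (f : I -> T -> T') i :
  D i -> measurable_wrt (gen_by D f) (f i).
Proof. by move=> Di _ B mB; rewrite setTI; exact: sub_gen_by. Qed.

(** * Products along words *)

Section products.
Context (R : realType) (b : nat) (d : measure_display) (Omega : measurableType d).
Variable X : seq 'I_b -> {mfun Omega >-> R}.
Hypothesis X_ge0 : forall u w, (0 <= X u w)%R.
Local Notation Y := (Yprod X [::]).

Lemma Yprod_ge0 v u w : (0 <= Yprod X v u w)%R.
Proof. exact: prodr_ge0. Qed.

Lemma Yprod_nil v w : Yprod X v [::] w = 1%R.
Proof. by rewrite /Yprod big_ord0. Qed.

Lemma measurable_Yprod v u : measurable_fun setT (Yprod X v u).
Proof. exact: measurable_prod. Qed.

Lemma measurable_EYprod D v u : measurable_fun D (fun w => (Yprod X v u w)%:E).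
Proof. by apply/measurable_EFinP/measurable_funTS; exact: measurable_Yprod. Qed.

Lemma Yprod_cat u v w : Y (u ++ v) w = (Y u w * Yprod X u v w)%R.
Proof.
rewrite /Yprod size_cat big_split_ord /=; congr (_ * _)%R.
  by apply: eq_bigr => i _; rewrite takel_cat.
apply: eq_bigr => i _; by rewrite -addnS take_cat ltnNge leq_addr addKn.
Qed.

Lemma YprodE u w : Y u w = (\prod_(1 <= k < (size u).+1) X (take k u) w)%R.
Proof. by rewrite big_add1 /= big_mkord. Qed.

Lemma Yprod1 j w : Y [:: j] w = X [:: j] w.
Proof. by rewrite YprodE /= big_nat1. Qed.

Lemma measurable_wrt_F_Yprod u n : (size u <= n)%N ->
  measurable_wrt (F_gen X n) (Y u).
Proof.
move=> un; apply: (@measurable_prod _ (g_sigma_algebraType (F_gen X n))) => i _.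
apply: (measurable_wrt_gen_by (f := fun u => X u : Omega -> R)).
by rewrite /= (leq_trans _ un)// size_take; case: ifP.
Qed.

Lemma F_gen_measurable n : <<s F_gen X n >> `<=` measurable.
Proof. by apply: gen_by_measurable => u _; exact: measurable_funP. Qed.

Lemma F_gen_incr n : <<s F_gen X n >> `<=` <<s F_gen X n.+1 >>.
Proof.
apply: smallest_sub; first exact: smallest_sigma_algebra.
move=> _ [u /= un [B mB <-]]; apply: sub_sigma_algebra.
by exists u; [exact: leqW|exists B].
Qed.

End products.

(** * The total masses and their almost sure limit *)

Section total_mass.
Context (R : realType) (b : nat) (hb : (2 <= b)%N).
Local Notation Sigma := (symb R hb).
Context (d : measure_display) (Omega : measurableType d).
Variables (P : probability Omega R) (nu : probability Sigma R).
Variable X : seq 'I_b -> {RV P >-> R}.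
Hypothesis X_ge0 : forall u w, (0 <= X u w)%R.
Local Notation Y := (Yprod X [::]).
Local Notation Z := (Zmass X nu).

Lemma Qprod_restr n w (x : Sigma) : Qprod X n (w, x) = Y (restr x n) w.
Proof.
rewrite YprodE size_restr /Qprod; apply: eq_big_nat => k /andP[_].
by rewrite ltnS => kn; rewrite take_restr.
Qed.

Lemma Zmass_integral n w : Z n w = \int[nu]_x (Y (restr x n) w)%:E.
Proof.
rewrite (integral_restr nu n (g := fun u => (Y u w)%:E)) => // u.
by rewrite lee_fin Yprod_ge0.
Qed.

Lemma Zmass_ge0 n w : 0 <= Z n w.
Proof. by apply: sume_ge0 => u _; rewrite mule_ge0// lee_fin Yprod_ge0. Qed.

Lemma Zmass_fin_num n w : Z n w \is a fin_num.
Proof.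
apply/sum_fin_numP => u _ _; apply: fin_numM => //.
by apply: fin_num_measure; exact: measurable_cyl.
Qed.

Lemma measurable_Zmass n : measurable_fun setT (Z n).
Proof.
apply: emeasurable_sum => u; apply: emeasurable_funM => //.
exact: measurable_EYprod.
Qed.

Lemma measurable_wrt_Zmass n : measurable_wrt (F_gen X n) (Z n).
Proof.
apply: (@emeasurable_sum _ (g_sigma_algebraType (F_gen X n))) => u.
apply: emeasurable_funM; last exact: measurable_cst.
by apply/measurable_EFinP; apply: measurable_wrt_F_Yprod; rewrite size_tuple.
Qed.

Lemma Yprod_le_Zmass u w : (Y u w)%:E * nu (cyl u) <= Z (size u) w.
Proof.
rewrite /Zmass (bigD1 (in_tuple u))//= leeDl// sume_ge0// => v _.
by rewrite mule_ge0// lee_fin Yprod_ge0.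
Qed.

Lemma measurable_Zlim : measurable_fun setT (Zlim X nu).
Proof. by apply: measurable_fun_limn_esup => n; exact: measurable_Zmass. Qed.

Lemma Zlim_ge0 w : 0 <= Zlim X nu w.
Proof.
rewrite /Zlim limn_esup_lim; apply: lime_ge; first exact: is_cvg_esups.
apply: nearW => n; apply: le_trans (Zmass_ge0 n w) _.
by apply: ereal_sup_ubound; exists n => /=.
Qed.

Hypothesis X_mart : forall u j, (1 <= size u)%N ->
  is_cond_exp P (F_gen X (size u)) (Y (rcons u j)) (Y u).
Hypothesis X_mean : forall j, 'E_P[X [:: j]] = 1.

(** Induction on the last letter. The martingale hypothesis starts at words of length 1, so
    one-letter words rest on [X_mean]. *)
Lemma integral_Yprod u : \int[P]_w (Y u w)%:E = 1.
Proof.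
elim/last_ind: u => [|[|i u] j IH].
- under eq_integral do rewrite Yprod_nil.
  by rewrite integral_cst//= probability_setT mule1.
- by under eq_integral do rewrite Yprod1; rewrite -(X_mean j) unlock.
have [_ _ _ /(_ setT) <-//] := X_mart j (isT : (1 <= size (i :: u))%N).
exact: (@measurableT _ (g_sigma_algebraType _)).
Qed.

(** Over an event of level [n], each word of length [n.+1] may be replaced by its prefix of length
    [n]; the cylinder masses then add up by [sum_cyl_take]. *)
Lemma Zmass_martingale n A : (0 < n)%N -> <<s F_gen X n >> A ->
  \int[P]_(w in A) Z n.+1 w = \int[P]_(w in A) Z n w.
Proof.
move=> n0 FA; have mA := F_gen_measurable FA.
have intZ m : \int[P]_(w in A) Z m w =
    \sum_(u : m.-tuple 'I_b) (\int[P]_(w in A) (Y u w)%:E) * nu (cyl u).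
  rewrite ge0_integral_sum//; last 2 first.
  - by move=> u; apply: emeasurable_funM => //; exact: measurable_EYprod.
  - by move=> u w _; rewrite mule_ge0// lee_fin Yprod_ge0.
  apply: eq_bigr => u _; rewrite ge0_integralZr//; first exact: measurable_EYprod.
  by move=> w _; rewrite lee_fin Yprod_ge0.
rewrite !intZ.
rewrite -(sum_cyl_take nu (g := fun u => \int[P]_(w in A) (Y u w)%:E)
  (leqnSn n)); last first.
  by move=> u; apply: integral_ge0 => w _; rewrite lee_fin Yprod_ge0.
apply: eq_bigr => u _; congr (_ * _).
have := size_tuple u; case/lastP: (tval u) => [//|v j].
rewrite size_rcons => -[vn]; rewrite -cats1 -vn take_size_cat// cats1.
have v0 : (0 < size v)%N by rewrite vn.
by have [_ _ _ ->//] := X_mart j v0; rewrite vn.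
Qed.

Lemma integral_Zmass n : \int[P]_w Z n w = 1.
Proof.
rewrite ge0_integral_sum//; last 2 first.
- move=> u; apply: emeasurable_funM => //.
  exact: measurable_EYprod.
- by move=> u w _; rewrite mule_ge0// lee_fin Yprod_ge0.
rewrite -(probability_setT nu) -(sum_cyl nu n); apply: eq_bigr => u _.
rewrite ge0_integralZr ?integral_Yprod ?mul1e//; first exact: measurable_EYprod.
by move=> w _; rewrite lee_fin Yprod_ge0.
Qed.

Lemma ae_Zmass_cvg : {ae P, forall w, Z n w @[n --> \oo] --> Zlim X nu w}.
Proof.
have Zfin n w : (fine (Z n.+1 w))%:E = Z n.+1 w by rewrite fineK// Zmass_fin_num.
have intZ A n : \int[P]_(w in A) (fine (Z n.+1 w))%:E = \int[P]_(w in A) Z n.+1 w.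
  by apply: eq_integral => w _; exact: Zfin.
have : {ae P, forall w, limn_einf (fun n => (fine (Z n.+1 w))%:E) =
                       limn_esup (fun n => (fine (Z n.+1 w))%:E)}.
  (* Time is shifted by one because the martingale identity for [Z] is available from time 1 on. *)
  apply: (martingale_convergence (G := fun n => F_gen X n.+1)).
  - by move=> n; exact: F_gen_measurable.
  - by move=> n; exact: F_gen_incr.
  - by move=> n w; rewrite fine_ge0// Zmass_ge0.
  - move=> n; apply/measurable_EFinP.
    have -> : EFin \o (fun w => fine (Z n.+1 w)) = Z n.+1.
      by apply/funext => w; exact: Zfin.
    exact: measurable_wrt_Zmass.
  - by move=> n; rewrite intZ integral_Zmass ltry.
  - by move=> n A FA; rewrite !intZ Zmass_martingale.
apply: filterS => w.
rewrite (_ : (fun n => _) = (fun n => Z n.+1 w)); last by apply/funext.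
rewrite (limn_einf_shiftS (Z ^~ w)) (limn_esup_shiftS (Z ^~ w)).
rewrite -[limn_esup _]/(Zlim X nu w).
exact: cvg_limn_einf_esup.
Qed.


End total_mass.

(** Almost everywhere [g] is the lower limit of the [f n], to which Fatou's lemma applies. The bound
    is asked from [N] on only, as it will be known for large indices. *)
Lemma fatou_ae d (T : measurableType d) (R : realType)
    (mu : {measure set T -> \bar R}) (D : set T) (f : nat -> T -> \bar R)
    (g : T -> \bar R) (c : \bar R) (N : nat) : measurable D ->
  (forall n, measurable_fun setT (f n)) -> (forall n x, 0 <= f n x) ->
  measurable_fun setT g -> (forall x, 0 <= g x) ->
  {ae mu, forall x, f n x @[n --> \oo] --> g x} ->
  (forall n, (N <= n)%N -> \int[mu]_(x in D) f n x <= c) ->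
  \int[mu]_(x in D) g x <= c.
Proof.
move=> mD mf f0 mg g0 fg fc.
have minf : measurable_fun setT (fun x => limn_einf (f ^~ x)).
  apply: measurableT_comp => //; apply: measurable_fun_limn_esup => n.
  exact: measurableT_comp.
apply: (@le_trans _ _ (\int[mu]_(x in D) limn_einf (f ^~ x))).
  apply: ae_ge0_le_integral => //.
  - exact: measurable_funTS.
  - move=> x _; rewrite limn_einf_lim; apply: lime_ge; first exact: is_cvg_einfs.
    by apply: nearW => n; apply: le_ereal_inf_tmp => _ [m _ <-].
  - exact: measurable_funTS.
  - by apply: filterS fg => x /cvg_limn_einf_sup[-> _].
apply: (le_trans (fatou _ _ _ _)) => //; first by move=> n; exact: measurable_funTS.
rewrite limn_einf_lim; apply: lime_le; first exact: is_cvg_einfs.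
near=> n; apply: le_trans (fc n _); first by apply: ereal_inf_lbound; exists n => /=.
by near: n; exists N.
Unshelve. all: by end_near. Qed.

Lemma measurable_wrt_sub (T : pointedType) d' (T' : measurableType d')
    (G G' : set (set T)) (f : T -> T') : <<s G >> `<=` <<s G' >> ->
  measurable_wrt G f -> measurable_wrt G' f.
Proof. by move=> GG' mf _ B mB; apply: GG'; exact: mf. Qed.

(** * The size-biased measure on events of finite level *)

Section size_biased.
Context (R : realType) (b : nat) (hb : (2 <= b)%N).
Local Notation Sigma := (symb R hb).
Context (d : measure_display) (Omega : measurableType d).
Variables (P : probability Omega R) (nu : probability Sigma R).
Variable X : seq 'I_b -> {RV P >-> R}.
Hypothesis X_ge0 : forall u w, (0 <= X u w)%R.
Local Notation Y := (Yprod X [::]).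
Local Notation Z := (Zmass X nu).
Local Notation Ft := (@Ft_gen R b hb d Omega X).
Local Notation Fts := (@Ft_gens R b hb d Omega X).

(** The common term of [Lsup] and [Ssum], read off a word instead of a point. *)
Definition cylmass (u : seq 'I_b) (w : Omega) : \bar R :=
  (Y u w)%:E * nu (cyl u : set Sigma).

Lemma cylmass_ge0 u w : 0 <= cylmass u w.
Proof. by rewrite mule_ge0// lee_fin Yprod_ge0. Qed.

Lemma measurable_cylmass u : measurable_fun setT (cylmass u).
Proof. by apply: emeasurable_funM => //; exact: measurable_EYprod. Qed.

Lemma measurable_wrt_Ft_Qprod k n : (k <= n)%N ->
  measurable_wrt (Ft n) (Qprod X k).
Proof.
move=> kn; apply: (@measurable_prod _ (g_sigma_algebraType (Ft n))) => i.
rewrite mem_index_iota ltnS => /andP[i0 ik] _ B mB; rewrite setTI.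
apply: sub_sigma_algebra; left; exists i; first by rewrite /= i0 (leq_trans ik).
by exists B => //; rewrite setTI.
Qed.

Lemma measurable_wrt_Ft_cylmass k n : (k <= n)%N ->
  measurable_wrt (Ft n) (fun p => cylmass (restr p.2 k) p.1).
Proof.
move=> kn; rewrite /measurable_wrt.
apply: (@emeasurable_funM _ (g_sigma_algebraType (Ft n))).
  apply/measurable_EFinP; rewrite (_ : (fun _ => _) = Qprod X k).
    exact: measurable_wrt_Ft_Qprod.
  by apply/funext => -[w x] /=; rewrite Qprod_restr.
have msnd : measurable_fun (setT : set (g_sigma_algebraType (Ft n)))
    (snd : _ -> Sigma).
  by move=> _ B mB; apply: sub_sigma_algebra; right; exists B.
exact: (measurableT_comp (measurable_fun_restr k (fun u => nu (cyl u))) msnd).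
Qed.

Lemma Ft_sub_Otilde n : (1 <= n)%N ->
  <<s Ft n >> `<=` <<s Fts >>.
Proof. by move=> n1 A FA; apply: sub_sigma_algebra; exists n. Qed.

Variables (Pt Qt : probability (Otilde hb X) R).
Hypothesis HPt : is_Ptilde P nu Pt.
Hypothesis HQt : is_Qtilde Pt Qt.

(** At level [n] the density of [Qt] is [Qprod X n], and both it and the event depend on the point
    only through its first [n] letters; the integral over [nu] becomes a sum over cylinders. [HPt]
    and [HQt] enter the proof through this formula alone. *)
Lemma Qtilde_prefix n (A : seq 'I_b -> set Omega) : (1 <= n)%N ->
  (forall u, measurable (A u)) ->
  <<s Ft n >> [set p | A (restr p.2 n) p.1] ->
  Qt [set p | A (restr p.2 n) p.1] =
  \sum_(u : n.-tuple 'I_b) (\int[P]_(w in A u) (Y u w)%:E) * nu (cyl u).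
Proof.
move=> n1 mA FA; set B := (X in Qt X).
have mB : measurable (B : set (Otilde hb X)) by exact: (Ft_sub_Otilde n1).
have -> : Qt B = \int[Qt]_p (\1_B p)%:E by rewrite integral_indic// setIT.
rewrite (HQt n1); last 2 first.
- rewrite /measurable_wrt; apply/measurable_EFinP.
  exact: (@measurable_indic _ (g_sigma_algebraType (Ft n))).
- by move=> p; rewrite lee_fin.
have Qprod_ge0 (p : Omega * Sigma) : (0 <= Qprod X n p)%R.
  by rewrite /Qprod; apply: prodr_ge0 => k _; exact: X_ge0.
rewrite HPt; last 2 first.
- apply: emeasurable_funM; apply/measurable_EFinP; first exact: measurable_indic.
  apply: (measurable_wrt_sub (Ft_sub_Otilde n1)).
  exact: measurable_wrt_Ft_Qprod.
- by move=> p; rewrite -EFinM lee_fin mulr_ge0.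
pose g w u : \bar R := (\1_(A u) w)%:E * (Y u w)%:E.
have g0 w u : 0 <= g w u by rewrite /g -EFinM lee_fin mulr_ge0// Yprod_ge0.
transitivity (\int[P]_w \sum_(u : n.-tuple 'I_b) g w u * nu (cyl u)).
  apply: eq_integral => w _; rewrite -(integral_restr nu n (g0 w)).
  by apply: eq_integral => x _; rewrite /g Qprod_restr !indicE.
have mg u : measurable_fun setT (g ^~ u).
  apply: emeasurable_funM; last exact: measurable_EYprod.
  by apply/measurable_EFinP; exact: measurable_indic.
rewrite ge0_integral_sum//; last 2 first.
- by move=> u; apply: emeasurable_funM.
- by move=> u w _; rewrite mule_ge0.
apply: eq_bigr => u _; rewrite ge0_integralZr//; congr (_ * _).
rewrite [RHS]integral_mkcond; apply: eq_integral => w _.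
by rewrite epatch_indic /= muleC.
Qed.

End size_biased.

(** * Singularity: Qt(L = oo) + E(Z) <= 1 *)

Section singularity.
Context (R : realType) (b : nat) (hb : (2 <= b)%N).
Local Notation Sigma := (symb R hb).
Context (d : measure_display) (Omega : measurableType d).
Variables (P : probability Omega R) (nu : probability Sigma R).
Variable X : seq 'I_b -> {RV P >-> R}.
Hypothesis X_ge0 : forall u w, (0 <= X u w)%R.
Local Notation Y := (Yprod X [::]).
Local Notation Z := (Zmass X nu).
Local Notation Ft := (@Ft_gen R b hb d Omega X).
Local Notation cylmass := (cylmass nu X).
Hypothesis X_mart : forall u j, (1 <= size u)%N ->
  is_cond_exp P (F_gen X (size u)) (Y (rcons u j)) (Y u).
Hypothesis X_mean : forall j, 'E_P[X [:: j]] = 1.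
Variables (Pt Qt : probability (Otilde hb X) R).
Hypothesis HPt : is_Ptilde P nu Pt.
Hypothesis HQt : is_Qtilde Pt Qt.

Lemma integral_Zlim_le1 : \int[P]_w Zlim X nu w <= 1.
Proof.
apply: (fatou_ae (f := Z) (N := 0%N)) => //.
- exact: measurable_Zmass.
- exact: Zmass_ge0.
- exact: measurable_Zlim.
- exact: Zlim_ge0.
- exact: ae_Zmass_cvg.
- by move=> n _; rewrite integral_Zmass.
Qed.

(** Integer thresholds make the event of infinite [Lsup] a countable intersection. *)
Definition exceeds (M : nat) (n : nat) : set (Otilde hb X) :=
  [set p | exists2 k, (k <= n)%N & M%:R%:E < cylmass (restr p.2 k) p.1].

Lemma measurable_wrt_exceeds M n : <<s Ft n >> (exceeds M n).
Proof.
rewrite [X in <<s _ >> X](_ : _ = \bigcup_(k in `I_n.+1)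
    [set p : Omega * Sigma | M%:R%:E < cylmass (restr p.2 k) p.1]); last first.
  by apply/seteqP; split => p [k]; exists k.
apply: (@bigcup_measurable _ (g_sigma_algebraType (Ft n))) => k; rewrite /= ltnS => kn.
rewrite -[X in measurable X]setTI.
apply: (@emeasurable_fun_o_infty _ (g_sigma_algebraType (Ft n))) => //.
exact: measurable_wrt_Ft_cylmass.
Qed.

Definition Zexceeds (M n : nat) : set Omega :=
  [set w | exists2 k, (k <= n)%N & M%:R%:E < Z k w].

Lemma measurable_exists_gt (f : nat -> Omega -> \bar R) (M n : nat) :
  (forall k, measurable_fun setT (f k)) ->
  measurable [set w | exists2 k, (k <= n)%N & M%:R%:E < f k w].
Proof.
move=> mf; rewrite [X in measurable X](_ : _ = \bigcup_(k in `I_n.+1)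
    [set w | M%:R%:E < f k w]); last first.
  by apply/seteqP; split => p [k]; exists k.
apply: bigcup_measurable => k _; rewrite -[X in measurable X]setTI.
exact: emeasurable_fun_o_infty.
Qed.

(** A term above [M] on the spine forces some [Z k] above [M], so the first summand is at most the
    integral of [Z n] over [Zexceeds M n]. *)
Lemma Qtilde_exceeds M n : (1 <= n)%N ->
  Qt (exceeds M n) + \int[P]_(w in ~` Zexceeds M n) Z n w <= 1.
Proof.
move=> n1; pose A u := [set w | exists2 k, (k <= n)%N & M%:R%:E < cylmass (take k u) w].
have mA u : measurable (A u).
  by apply: measurable_exists_gt => k; exact: measurable_cylmass.
have mZ : measurable (Zexceeds M n).
  by apply: measurable_exists_gt => k; exact: measurable_Zmass.
have exceedsE : exceeds M n = [set p | A (restr p.2 n) p.1].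
  by apply/seteqP; split => p [k kn]; exists k; rewrite ?take_restr// -(take_restr _ kn).
rewrite exceedsE (Qtilde_prefix X_ge0 HPt HQt n1 mA); last first.
  by rewrite -exceedsE; exact: measurable_wrt_exceeds.
(* The right-hand side 1 is the mean of [Z n], split over [Zexceeds M n] and its complement. *)
rewrite -(integral_Zmass nu X_ge0 X_mart X_mean n) -(setUv (Zexceeds M n)).
rewrite ge0_integral_setU//; last 4 first.
- exact: measurableC.
- by apply: measurable_funTS; exact: measurable_Zmass.
- by move=> w _; exact: Zmass_ge0.
- by apply/disj_setPCl.
rewrite leeD2r// ge0_integral_sum//; last 2 first.
- by move=> u; apply: emeasurable_funM => //; exact: measurable_EYprod.
- by move=> u w _; rewrite mule_ge0// lee_fin Yprod_ge0.
apply: lee_sum => u _; rewrite ge0_integralZr//; last 2 first.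
- exact: measurable_EYprod.
- by move=> w _; rewrite lee_fin Yprod_ge0.
rewrite lee_wpmul2r//; apply: ge0_subset_integral => //.
- exact: measurable_EYprod.
- by move=> w _; rewrite lee_fin Yprod_ge0.
move=> w [k kn Mk]; exists k => //; apply: lt_le_trans Mk _.
have {2}-> : k = size (take k u) by rewrite size_takel// size_tuple.
exact: Yprod_le_Zmass.
Qed.

(** This event lies in the complement of every [Zexceeds M n] and does not vary with [n], so Fatou's
    lemma can be used on it. *)
Let below M := [set w | forall k, Z k w <= M%:R%:E].

Let measurable_below M : measurable (below M).
Proof.
rewrite [X in measurable X](_ : _ = \bigcap_k [set w | Z k w <= M%:R%:E]); last first.
  by apply/seteqP; split => [w wM k _|w wM k]; exact: wM.
apply: bigcapT_measurable => k; rewrite -[X in measurable X]setTI.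
by apply: emeasurable_fun_infty_c => //; exact: measurable_Zmass.
Qed.

Lemma measurable_exceeds M n : (1 <= n)%N -> measurable (exceeds M n).
Proof. by move=> n1; apply: (Ft_sub_Otilde n1); exact: measurable_wrt_exceeds. Qed.

(** With [n] fixed, [Qtilde_exceeds] is used at every level [m >= n], where [exceeds] is larger;
    Fatou's lemma lets [m] tend to infinity. *)
Let exceeds_below M n : (1 <= n)%N ->
  Qt (exceeds M n) + \int[P]_(w in below M) Zlim X nu w <= 1.
Proof.
move=> n1; have Qfin : Qt (exceeds M n) \is a fin_num.
  by apply: fin_num_measure; exact: measurable_exceeds.
rewrite -leeBrDl//; apply: (fatou_ae (f := Z) (N := n)) => //.
- exact: measurable_Zmass.
- exact: Zmass_ge0.
- exact: measurable_Zlim.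
- exact: Zlim_ge0.
- exact: ae_Zmass_cvg.
move=> m nm; rewrite leeBrDl//.
apply: le_trans (Qtilde_exceeds M (leq_trans n1 nm)); apply: leeD.
- have mEn := measurable_exceeds M n1.
  have mEm := measurable_exceeds M (leq_trans n1 nm).
  apply: le_measure; rewrite ?inE//.
  by move=> p [k kn]; exists k => //; exact: leq_trans nm.
- apply: ge0_subset_integral => //.
  + apply: measurableC; apply: measurable_exists_gt; exact: measurable_Zmass.
  + by apply: measurable_funTS; exact: measurable_Zmass.
  + by move=> w _; exact: Zmass_ge0.
  + by move=> w wM [k _]; rewrite ltNge wM.
Qed.

(** The index [n.+1] keeps to the levels from 1 on, which generate the sigma-field of [Otilde]. *)
Lemma Lsup_infty_exceeds :
  [set p : Otilde hb X | Lsup X nu p = +oo] =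
  \bigcap_M \bigcup_n exceeds M n.+1.
Proof.
apply/seteqP; split => [p /= Lp M _|p Mp /=].
  have /ereal_sup_gt[_ [n _ <-] Mn] : M%:R%:E < Lsup X nu p by rewrite Lp ltry.
  by exists n => //; exists n.
apply: eq_infty => r; pose M := (Num.truncn r).+1.
have [n _ [k kn Mk]] := Mp M I; apply: (@le_trans _ _ (cylmass (restr p.2 k) p.1)).
  apply/ltW; apply: le_lt_trans Mk; rewrite lee_fin; apply/ltW.
  exact: truncnS_gt.
by apply: ereal_sup_ubound; exists k.
Qed.

Lemma measurable_Lsup_infty : measurable [set p : Otilde hb X | Lsup X nu p = +oo].
Proof.
rewrite Lsup_infty_exceeds; apply: bigcapT_measurable => M.
by apply: bigcupT_measurable => n; exact: measurable_exceeds.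
Qed.

(** Continuity of [Qt] from below lets [n] tend to infinity in [exceeds_below]. *)
Let Lsup_infty_below M :
  Qt [set p | Lsup X nu p = +oo] + \int[P]_(w in below M) Zlim X nu w <= 1.
Proof.
have mE n : measurable (exceeds M n.+1) by exact: measurable_exceeds.
have mU : measurable (\bigcup_n exceeds M n.+1) by exact: bigcupT_measurable.
have Ifin : \int[P]_(w in below M) Zlim X nu w \is a fin_num.
  rewrite ge0_fin_numE; last by apply: integral_ge0 => w _; exact: Zlim_ge0.
  apply: (@le_lt_trans _ _ 1); last exact: ltry.
  apply: le_trans (exceeds_below M (ltn0Sn 0)); exact: leeDr.
rewrite -leeBrDr//; apply: (@le_trans _ _ (Qt (\bigcup_n exceeds M n.+1))).
  apply: le_measure; rewrite ?inE//; first exact: measurable_Lsup_infty.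
  by rewrite Lsup_infty_exceeds => p; apply.
have nd : nondecreasing_seq (fun n => exceeds M n.+1).
  move=> m n mn; apply/subsetPset => p [k km]; exists k => //.
  exact: leq_trans km _.
have cvgQ := nondecreasing_cvg_mu (mu := Qt) mE mU nd.
rewrite -(cvg_lim _ cvgQ)//; apply: lime_le; first by apply/cvg_ex; eexists; exact: cvgQ.
by apply: nearW => n; rewrite leeBrDr//; exact: exceeds_below.
Qed.

Lemma ae_Zlim_fin_num : {ae P, forall w, Zlim X nu w \is a fin_num}.
Proof.
have Zint : P.-integrable setT (Zlim X nu).
  apply/integrableP; split; first exact: measurable_Zlim.
  under eq_integral do rewrite gee0_abs ?Zlim_ge0//.
  by apply: le_lt_trans integral_Zlim_le1 _; exact: ltry.
by have := integrable_ae measurableT Zint; apply: filterS => w; exact.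
Qed.

(** Almost surely the finite numbers [Z n w] converge to a finite limit, and so are bounded. *)
Let ae_below : {ae P, forall w, (\bigcup_M below M) w}.
Proof.
apply: filterS2 (ae_Zmass_cvg nu X_ge0 X_mart X_mean) ae_Zlim_fin_num => w cvgZ Zfin.
move: cvgZ; rewrite -(fineK Zfin) => /fine_cvgP[_ cvgfZ].
have /cvg_seq_bounded[C [_ /(_ (C + 1)%R)]] : cvgn (fine \o Z ^~ w).
  by apply/cvg_ex; eexists; exact: cvgfZ.
rewrite ltrDl ltr01 => /(_ isT) ZC.
exists (Num.truncn (C + 1)%R).+1 => // n.
rewrite -(fineK (Zmass_fin_num nu X n w)) lee_fin.
apply: le_trans (ltW (truncnS_gt _)); apply: le_trans (ZC n _) => //.
exact: ler_norm.
Qed.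

(** The events [below M] increase to an almost sure event, so monotone convergence lets [M] tend to
    infinity. *)
Lemma Lsup_infty_Zlim :
  Qt [set p | Lsup X nu p = +oo] + \int[P]_w Zlim X nu w <= 1.
Proof.
have Qfin : Qt [set p | Lsup X nu p = +oo] \is a fin_num.
  by apply: fin_num_measure; exact: measurable_Lsup_infty.
have mU : measurable (\bigcup_M below M) by exact: bigcupT_measurable.
rewrite -leeBrDl//.
apply: (@le_trans _ _ (\int[P]_(w in \bigcup_M below M) Zlim X nu w)).
  rewrite [leRHS]integral_mkcond; apply: ae_ge0_le_integral => //.
  - by move=> w _; exact: Zlim_ge0.
  - exact: measurable_Zlim.
  - by move=> w _; rewrite /patch; case: ifP => // _; exact: Zlim_ge0.
  - apply/(measurable_restrictT _ _).1 => //; apply/measurable_funTS.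
    exact: measurable_Zlim.
  - by apply: filterS ae_below => w bw _; rewrite /patch mem_set.
have nd : nondecreasing_seq below.
  move=> m n mn; apply/subsetPset => w wm k; apply: le_trans (wm k) _.
  by rewrite lee_fin ler_nat.
have cvgI := ge0_nondecreasing_set_cvg_integral (mu := P) (f := Zlim X nu) nd
  measurable_below
  (fun i => measurable_funTS (measurable_Zlim nu X)) (fun _ w _ => Zlim_ge0 nu X_ge0 w).
rewrite -(cvg_lim _ cvgI)//; apply: lime_le; first by apply/cvg_ex; eexists; exact: cvgI.
by apply: nearW => M; rewrite leeBrDl//; exact: Lsup_infty_below.
Qed.

End singularity.

(** * Regularity: Qt(S < oo) <= E(Z) *)

Section regularity.
Context (R : realType) (b : nat) (hb : (2 <= b)%N).
Local Notation Sigma := (symb R hb).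
Context (d : measure_display) (Omega : measurableType d).
Variables (P : probability Omega R) (nu : probability Sigma R).
Variable X : seq 'I_b -> {RV P >-> R}.
Hypothesis X_ge0 : forall u w, (0 <= X u w)%R.
Local Notation Y := (Yprod X [::]).
Local Notation Z := (Zmass X nu).
Local Notation Ft := (@Ft_gen R b hb d Omega X).
Local Notation cylmass := (cylmass nu X).
Hypothesis X_mart : forall u j, (1 <= size u)%N ->
  is_cond_exp P (F_gen X (size u)) (Y (rcons u j)) (Y u).
Hypothesis X_mean : forall j, 'E_P[X [:: j]] = 1.
Variables (Pt Qt : probability (Otilde hb X) R).
Hypothesis HPt : is_Ptilde P nu Pt.
Hypothesis HQt : is_Qtilde Pt Qt.
Hypothesis X_spine : forall (x : Sigma) (k : nat) (j : 'I_b) (u : seq 'I_b),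
  j != x k -> is_cond_exp P (H_gen X x) (Yprod X (restr x k) (j :: u)) (cst 1%R).

(** Induction on the last letter: a word that has left the spine stays off it. *)
Lemma split_prefix (x : Sigma) v : v = restr x (size v) \/
  exists k j v', v = restr x k ++ j :: v' /\ j != x k.
Proof.
elim/last_ind: v => [|v j [vx|[k [i [v' [-> ix]]]]]]; first by left.
- have [jx|jx] := eqVneq j (x (size v)).
    left; rewrite size_rcons {1}vx jx /restr /mkseq -addn1 iotaD map_cat /=.
    by rewrite cats1 add0n.
  by right; exists (size v), j, [::]; rewrite cats1 -vx.
- by right; exists k, i, (rcons v' j); rewrite rcons_cat.
Qed.

Lemma H_gen_measurable (x : Sigma) : <<s H_gen X x >> `<=` measurable.
Proof. by apply: gen_by_measurable => n _; exact: measurable_funP. Qed.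

Lemma measurable_wrt_H_Yprod (x : Sigma) k :
  measurable_wrt (H_gen X x) (Y (restr x k)).
Proof.
apply: (@measurable_prod _ (g_sigma_algebraType (H_gen X x))) => i _ /=.
rewrite take_restr; last by rewrite -[leqRHS](size_restr x k).
exact: (measurable_wrt_gen_by (f := fun n => X (restr x n) : Omega -> R)).
Qed.

Lemma measurable_wrt_H_cylmass (x : Sigma) k :
  measurable_wrt (H_gen X x) (cylmass (restr x k)).
Proof.
apply: (@emeasurable_funM _ (g_sigma_algebraType (H_gen X x))).
  by apply/measurable_EFinP; exact: measurable_wrt_H_Yprod.
exact: measurable_cst.
Qed.

(** If [v] leaves the spine after [k] letters, then [Y v] is [Y (restr x k)] times the product along
    the branch. The latter has conditional mean 1, and the remaining factors are measurable for the
    variables on the spine. *)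
Lemma integral_mul_branch (x : Sigma) (g : Omega -> R) v :
  measurable_wrt (H_gen X x) g -> (forall w, 0 <= g w)%R ->
  exists k, [/\ (k <= size v)%N, take k v = restr x k &
    \int[P]_w ((g w)%:E * (Y v w)%:E) = \int[P]_w ((g w)%:E * (Y (restr x k) w)%:E)].
Proof.
move=> mg g0; have [vx|[k [j [v' [vE jx]]]]] := split_prefix x v.
  by exists (size v); rewrite take_size -vx.
exists k; split.
- by rewrite vE size_cat size_restr leq_addr.
- by rewrite vE take_size_cat// size_restr.
pose h w := (g w * Y (restr x k) w)%:E.
have h0 w : 0 <= h w by rewrite lee_fin mulr_ge0// Yprod_ge0.
have mh : measurable_wrt (H_gen X x) h.
  apply/measurable_EFinP.
  apply: (@measurable_funM _ (g_sigma_algebraType (H_gen X x))) => //.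
  exact: measurable_wrt_H_Yprod.
have [_ _ _ condE] := X_spine v' jx.
have := ge0_integral_mul_sub_sigma (@H_gen_measurable x)
  (measurable_Yprod X (restr x k) (j :: v')) (Yprod_ge0 X_ge0 _ _)
  (measurable_cst (1 : R)%R) (fun=> ler01) (fun A HA => esym (condE A HA)) mh h0.
under [X in _ = X -> _]eq_integral do rewrite mule1.
move=> hE; rewrite -[RHS]/(\int[P]_w h w) -hE; apply: eq_integral => w _.
by rewrite vE Yprod_cat /h !EFinM muleA.
Qed.

Let spine n u w := \sum_(k < n.+1) cylmass (take k u) w.

(* Expand [Z n] over the words [v] of length [n]: conditionally on the
   variables read along [u], [Y v] has mean [Y] of the common prefix. *)
Lemma integral_mul_Zmass_le n u (g : Omega -> R) : size u = n ->
  measurable_wrt (H_gen X (extend R hb u)) g -> (forall w, 0 <= g w)%R ->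
  \int[P]_w ((g w)%:E * Z n w) <= \int[P]_w ((g w)%:E * spine n u w).
Proof.
move=> un mg g0; set x := extend R hb u in mg.
have xu k : (k <= n)%N -> restr x k = take k u.
  by move=> kn; rewrite -[in RHS](restr_extend R hb u) take_restr ?un.
have mgT : measurable_fun setT (EFin \o g).
  apply/measurable_EFinP => _ B mB; rewrite setTI; apply: (@H_gen_measurable x).
  by rewrite -[X in <<s _ >> X]setTI; exact: mg.
have gE0 w : 0 <= (g w)%:E by rewrite lee_fin.
have Y0 v w : 0 <= (Y v w)%:E by rewrite lee_fin Yprod_ge0.
have mgY v : measurable_fun setT (fun w => (g w)%:E * (Y v w)%:E).
  by apply: emeasurable_funM => //; exact: measurable_EYprod.
have gY0 v w : 0 <= (g w)%:E * (Y v w)%:E by rewrite mule_ge0.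
pose I v := \int[P]_w ((g w)%:E * (Y v w)%:E).
have I0 v : 0 <= I v by exact: integral_ge0.
have -> : \int[P]_w ((g w)%:E * Z n w) =
    \sum_(v : n.-tuple 'I_b) I v * nu (cyl v).
  under eq_integral => w _.
    rewrite ge0_sume_distrr; last by move=> v _; rewrite mule_ge0.
    under eq_bigr do rewrite muleA.
    over.
  rewrite ge0_integral_sum//; last 2 first.
  - by move=> v; apply: emeasurable_funM.
  - by move=> v w _; rewrite mule_ge0.
  by apply: eq_bigr => v _; rewrite ge0_integralZr.
have -> : \int[P]_w ((g w)%:E * spine n u w) =
    \sum_(k < n.+1) I (take k u) * nu (cyl (take k u)).
  under eq_integral => w _.
    rewrite ge0_sume_distrr; last by move=> v _; rewrite mule_ge0.
    under eq_bigr do rewrite muleA.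
    over.
  rewrite ge0_integral_sum//; last 2 first.
  - by move=> v; apply: emeasurable_funM.
  - by move=> v w _; rewrite mule_ge0.
  by apply: eq_bigr => v _; rewrite ge0_integralZr.
(* For each [v] the term of its branching level is completed by those of all other common prefixes
   with [u], which are nonnegative; the two sums can then be exchanged. *)
apply: (@le_trans _ _ (\sum_(v : n.-tuple 'I_b) \sum_(k < n.+1 | take k v == take k u)
    I (take k u) * nu (cyl v))).
  apply: lee_sum => v _.
  have [k [kn vk IvE]] := integral_mul_branch v mg g0.
  rewrite size_tuple in kn; rewrite {1}/I IvE (xu _ kn) -/(I (take k u)).
  rewrite (bigD1 (Ordinal (kn : (k < n.+1)%N)))/=; last by rewrite vk xu.
  by rewrite leeDl// sume_ge0// => i _; rewrite mule_ge0.
under eq_bigr do rewrite big_mkcond /=.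
(* For fixed [k], the words [v] that start with [take k u] have total mass [nu (cyl (take k u))]. *)
rewrite exchange_big /=; apply: lee_sum => k _; rewrite -big_mkcond /=.
rewrite -ge0_sume_distrr//.
have kn : (k <= n)%N by rewrite -ltnS.
have ku : size (take k u) = k by rewrite size_takel// un.
by rewrite -(sum_cyl_prefix nu (n := n) (u := take k u)) ku.
Qed.

Let low n u (K : R) := [set w | spine n u w <= K%:E].
Let high n (M : R) := [set w | M%:E < Z n w].

Let mlow n u K : measurable (low n u K).
Proof.
rewrite -[X in measurable X]setTI; apply: emeasurable_fun_infty_c => //.
by apply: emeasurable_sum => k; exact: measurable_cylmass.
Qed.

Let mhigh n M : measurable (high n M).
Proof.
rewrite -[X in measurable X]setTI; apply: emeasurable_fun_o_infty => //.
exact: measurable_Zmass.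
Qed.

Let EY0 u w : 0 <= (Y u w)%:E.
Proof. by rewrite lee_fin Yprod_ge0. Qed.

(** Markov's inequality under the weight [g], which is [Y u] restricted to [low]: [M] times the left
    side is at most the integral of [g] times [Z n], then of [g] times [spine], hence at most [K]
    times the mean 1 of [Y u]. *)
Let low_high n u K M : size u = n -> (0 <= K)%R -> (0 < M)%R ->
  \int[P]_(w in low n u K `&` high n M) (Y u w)%:E <= (K / M)%:E.
Proof.
move=> un K0 M0; pose g w : R := (\1_(low n u K) w * Y u w)%R.
have g0 w : (0 <= g w)%R by rewrite mulr_ge0// Yprod_ge0.
have xu k : (k <= n)%N -> restr (extend R hb u) k = take k u.
  by move=> kn; rewrite -[in RHS](restr_extend R hb u) take_restr ?un.
have mg : measurable_wrt (H_gen X (extend R hb u)) g.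
  pose HT : measurableType _ := g_sigma_algebraType (H_gen X (extend R hb u)).
  apply: (@measurable_funM _ HT).
    apply: measurable_indic; rewrite -[X in measurable X]setTI.
    apply: (@emeasurable_fun_infty_c _ HT) => //.
    apply: (@emeasurable_sum _ HT) => k.
    by rewrite -xu -1?ltnS//; exact: measurable_wrt_H_cylmass.
  rewrite -[X in Y X](restr_extend R hb u); exact: measurable_wrt_H_Yprod.
have mgT : measurable_fun setT (EFin \o g).
  apply/measurable_EFinP/measurable_funM; last exact: measurable_Yprod.
  exact: measurable_indic.
have spine0 w : 0 <= spine n u w by apply: sume_ge0 => k _; exact: cylmass_ge0.
rewrite EFinM -[leLHS]mule1 -(mulfV (lt0r_neq0 M0)) EFinM muleA lee_wpmul2r//.
  by rewrite lee_fin invr_ge0 ltW.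
rewrite muleC -ge0_integralZl//; last 3 first.
- exact: measurableI.
- exact: measurable_EYprod.
- by rewrite lee_fin ltW.
apply: (@le_trans _ _ (\int[P]_w ((g w)%:E * Z n w))).
  rewrite integral_mkcond; apply: ge0_le_integral => //.
  - by move=> w _; rewrite /patch; case: ifP => // _; rewrite mule_ge0// lee_fin ltW.
  - apply/(measurable_restrictT _ _).1; first exact: measurableI.
    by apply: emeasurable_funM => //; exact: measurable_EYprod.
  - apply: emeasurable_funM => //; exact: measurable_Zmass.
  - move=> w _; rewrite /patch; case: ifPn => [|_]; last first.
      by rewrite mule_ge0 ?lee_fin ?Zmass_ge0.
    rewrite inE => -[lw hw]; rewrite /g indicE mem_set// mul1r muleC.
    by apply: lee_wpmul2l => //; exact: (ltW hw).
apply: le_trans (integral_mul_Zmass_le un mg g0) _.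
apply: (@le_trans _ _ (\int[P]_w (K%:E * (Y u w)%:E))).
  apply: ge0_le_integral => //.
  - by move=> w _; apply: mule_ge0; [rewrite lee_fin|exact: spine0].
  - apply: emeasurable_funM => //; apply: emeasurable_sum => k.
    exact: measurable_cylmass.
  - by apply: emeasurable_funM => //; exact: measurable_EYprod.
  - move=> w _; rewrite /g indicE; have [lw|lw] := boolP (w \in _).
      by rewrite mul1r muleC lee_wpmul2r//; move: lw; rewrite inE.
    by rewrite mul0r mul0e mule_ge0.
rewrite ge0_integralZl//; last exact: measurable_EYprod.
by rewrite (integral_Yprod X_mart X_mean) mule1.
Qed.

Let Smass n (p : Omega * Sigma) := \sum_(k < n.+1) cylmass (restr p.2 k) p.1.

Let ft_Smass n (K : R) :
  <<s Ft n >> [set p : Omega * Sigma | Smass n p <= K%:E].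
Proof.
rewrite -[X in <<s _ >> X]setTI.
apply: (@emeasurable_fun_infty_c _ (g_sigma_algebraType (Ft n))) => //.
apply: (@emeasurable_sum _ (g_sigma_algebraType (Ft n))) => k.
by apply: measurable_wrt_Ft_cylmass; rewrite -ltnS.
Qed.

(** Each cylinder integral is split at [high n M]. On this event [low_high] applies and the weights
    [nu (cyl u)] sum to 1; off it the sum over [u] is at most [Z n], which there equals its
    truncation. *)
Let Qtilde_Smass n (K M : R) : (1 <= n)%N -> (0 <= K)%R -> (0 < M)%R ->
  Qt [set p | Smass n p <= K%:E] <=
  \int[P]_w (Num.min (fine (Z n w)) M)%:E + (K / M)%:E.
Proof.
move=> n1 K0 M0.
have SmassE : [set p | Smass n p <= K%:E] = [set p | low n (restr p.2 n) K p.1].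
  have spineE p : spine n (restr p.2 n) p.1 = Smass n p.
    by apply: eq_bigr => k _; rewrite take_restr// -ltnS.
  by apply/seteqP; split => p; rewrite /low/= spineE.
have := @ft_Smass n K; rewrite SmassE => mS.
rewrite (Qtilde_prefix X_ge0 HPt HQt (A := fun u => low n u K) n1 _ mS)//.
have mC : measurable (~` high n M) by exact: measurableC.
apply: (@le_trans _ _ (\sum_(u : n.-tuple 'I_b)
    (\int[P]_(w in ~` high n M) (Y u w)%:E + (K / M)%:E) * nu (cyl u))).
  apply: lee_sum => u _; rewrite lee_wpmul2r//.
  rewrite -[X in \int[P]_(w in X) _]setIT -(setUv (high n M)) setIUr addeC.
  rewrite ge0_integral_setU//; last 4 first.
  - exact: measurableI.
  - exact: measurableI.
  - exact: measurable_EYprod.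
  - by apply/disj_setPS => w [[_ ?] [_]].
  apply: leeD; first by apply: low_high => //; rewrite size_tuple.
  apply: ge0_subset_integral => //; first exact: measurableI.
  exact: measurable_EYprod.
have KM0 : 0 <= (K / M)%:E by rewrite lee_fin divr_ge0// ltW.
under eq_bigr => u _ do rewrite (ge0_muleDl _ (integral_ge0 _ (fun w _ => EY0 u w)) KM0).
rewrite big_split /= -ge0_sume_distrr// sum_cyl.
rewrite [X in (K / M)%:E * X](probability_setT nu) mule1 leeD2r//.
have -> : \sum_(u : n.-tuple 'I_b) (\int[P]_(w in ~` high n M) (Y u w)%:E) * nu (cyl u)
    = \int[P]_(w in ~` high n M) Z n w.
  rewrite ge0_integral_sum//; last 2 first.
  - by move=> u; apply: emeasurable_funM => //; exact: measurable_EYprod.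
  - by move=> u w _; rewrite mule_ge0.
  by apply: eq_bigr => u _; rewrite ge0_integralZr//; exact: measurable_EYprod.
rewrite integral_mkcond; apply: ge0_le_integral => //.
- by move=> w _; rewrite /patch; case: ifP => // _; exact: Zmass_ge0.
- apply/(measurable_restrictT _ _).1 => //.
  by apply: measurable_funTS; exact: measurable_Zmass.
- apply/measurable_EFinP/measurable_minr => //.
  by apply: measurableT_comp => //; exact: measurable_Zmass.
- move=> w _; rewrite /patch; case: ifPn => [|_].
    rewrite inE => /negP; rewrite -leNgt -{1 2}(fineK (Zmass_fin_num nu X n w)).
    by rewrite !lee_fin => /min_idPl ->.
  by rewrite lee_fin le_min fine_ge0 ?Zmass_ge0// ltW.
Qed.

(** Truncation supplies the dominating constant [M]; the [Z n] themselves need not be uniformly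
    integrable. *)
Let minZ_cvg (M : R) : (0 < M)%R ->
  \int[P]_w (Num.min (fine (Z n w)) M)%:E @[n --> \oo] -->
  \int[P]_w (Num.min (fine (Zlim X nu w)) M)%:E.
Proof.
move=> M0.
have mmin (f : Omega -> \bar R) : measurable_fun setT f ->
    measurable_fun setT (fun w => (Num.min (fine (f w)) M)%:E).
  move=> mf; apply/measurable_EFinP/measurable_minr => //.
  exact: measurableT_comp.
have cvg_ae : {ae P, forall w, setT w ->
    (Num.min (fine (Z n w)) M)%:E @[n --> \oo] --> (Num.min (fine (Zlim X nu w)) M)%:E}.
  apply: filterS2 (ae_Zmass_cvg nu X_ge0 X_mart X_mean)
    (ae_Zlim_fin_num nu X_ge0 X_mart X_mean) => w cvgZ Zfin _.
  move: cvgZ; rewrite -{1}(fineK Zfin) => /fine_cvgP[_ cvgZ].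
  apply: cvg_EFin; first exact: nearW.
  have cmin : continuous (fun r : R => Num.min r M).
    by move=> r; apply: continuous_min; [exact: cvg_id|exact: cvg_cst].
  apply: (@cvg_comp _ _ _ (fine \o Z ^~ w) (fun r => Num.min r M)); first exact: cvgZ.
  exact: cmin.
have intM : P.-integrable setT (cst M%:E) by exact: finite_measure_integrable_cst.
have bound : {ae P, forall w n, setT w -> `|(Num.min (fine (Z n w)) M)%:E| <= cst M%:E w}.
  apply: aeW => w n _; rewrite gee0_abs ?lee_fin ?ge_min ?lexx ?orbT//.
  by rewrite le_min fine_ge0 ?Zmass_ge0// ltW.
by have [] := dominated_convergence measurableT
  (fun n => mmin _ (measurable_Zmass nu X n)) (mmin _ (measurable_Zlim nu X))
  cvg_ae intM bound.
Qed.

Lemma measurable_Ssum :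
  measurable_fun (setT : set (Otilde hb X)) (Ssum X nu).
Proof.
apply: (@ge0_emeasurable_sum _ (Otilde hb X) R setT
  (fun k p => cylmass (restr p.2 k) p.1) xpredT) => [k p _ _|k _].
  exact: cylmass_ge0.
apply: (measurable_wrt_sub (Ft_sub_Otilde (n := k.+1) isT)).
exact: measurable_wrt_Ft_cylmass.
Qed.

Let measurable_Ssum_le (K : R) :
  measurable [set p : Otilde hb X | Ssum X nu p <= K%:E].
Proof.
rewrite -[X in measurable X]setTI; apply: emeasurable_fun_infty_c => //.
exact: measurable_Ssum.
Qed.

(** Partial sums are at most [Ssum], so [Qtilde_Smass] applies at each level [n >= 1]; [n] tends to
    infinity by [minZ_cvg], and the truncation is dropped. *)
Let Qtilde_Ssum_le (K M : R) : (0 <= K)%R -> (0 < M)%R ->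
  Qt [set p | Ssum X nu p <= K%:E] <= \int[P]_w Zlim X nu w + (K / M)%:E.
Proof.
move=> K0 M0; rewrite -leeBlDr//.
apply: (@le_trans _ _ (\int[P]_w (Num.min (fine (Zlim X nu w)) M)%:E)); last first.
  apply: ge0_le_integral => //.
  - by move=> w _; rewrite lee_fin le_min fine_ge0 ?Zlim_ge0// ltW.
  - apply/measurable_EFinP/measurable_minr => //.
    by apply: measurableT_comp => //; exact: measurable_Zlim.
  - exact: measurable_Zlim.
  (* Where the limit is infinite, [fine] gives 0 and the bound is trivial. *)
  - move=> w _; have := Zlim_ge0 nu X_ge0 w; case: (Zlim X nu w) => [r| |]//= r0.
      by rewrite lee_fin ge_min lexx.
    by rewrite leey.
rewrite -(cvg_lim _ (minZ_cvg M0))//; apply: lime_ge.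
  by apply/cvg_ex; eexists; exact: minZ_cvg.
near=> n; rewrite leeBlDr//; apply: le_trans (Qtilde_Smass _ K0 M0); last first.
  by near: n; exists 1%N.
apply: le_measure; rewrite ?inE//.
  apply: (Ft_sub_Otilde (n := n)); last exact: ft_Smass.
  by near: n; exists 1%N.
move=> p; apply: le_trans; rewrite /Smass.
rewrite -(big_mkord xpredT (fun k => cylmass (restr p.2 k) p.1)).
by apply: nneseries_lim_ge => k _ _; exact: cylmass_ge0.
Unshelve. all: by end_near. Qed.

(** For each integer [K], a large [M] makes the error [K / M] negligible; then [K] tends to infinity
    by continuity from below. *)
Lemma Ssum_finite_Zlim :
  Qt [set p | Ssum X nu p < +oo] <= \int[P]_w Zlim X nu w.
Proof.
have SsumE : [set p : Otilde hb X | Ssum X nu p < +oo] =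
    \bigcup_K [set p : Otilde hb X | Ssum X nu p <= K%:R%:E].
  have S0 p : 0 <= Ssum X nu p by apply: nneseries_ge0 => k _ _; exact: cylmass_ge0.
  apply/seteqP; split => [p /= Sp|p [K _ /=]]; last first.
    by move=> /le_lt_trans; apply; exact: ltry.
  exists (Num.truncn (fine (Ssum X nu p))).+1 => //=.
  rewrite -[leLHS]fineK ?ge0_fin_numE// lee_fin; apply: ltW; exact: truncnS_gt.
have mU : measurable (\bigcup_K [set p : Otilde hb X | Ssum X nu p <= K%:R%:E]).
  exact: bigcupT_measurable.
have nd : nondecreasing_seq (fun K => [set p : Otilde hb X | Ssum X nu p <= K%:R%:E]).
  move=> m n mn; apply/subsetPset => p /le_trans; apply.
  by rewrite lee_fin ler_nat.
have cvgQ := nondecreasing_cvg_mu (mu := Qt) (fun K => measurable_Ssum_le K%:R) mU nd.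
rewrite SsumE -(cvg_lim _ cvgQ)//; apply: lime_le.
  by apply/cvg_ex; eexists; exact: cvgQ.
apply: nearW => K; apply/lee_addgt0Pr => e e0 /=.
(* With this value as [M] one has [K / M <= e]; the successor keeps it positive at [K = 0]. *)
have M0 : (0 < K.+1%:R / e :> R)%R by rewrite divr_gt0.
apply: le_trans (Qtilde_Ssum_le (ler0n R K) M0) _; rewrite leeD2l// lee_fin.
by rewrite ler_pdivrMr// mulrCA mulfV ?gt_eqF// mulr1 ler_nat.
Qed.

End regularity.

(** * From the limit of the masses to the limit measure *)

Section limit_measure.
Context (R : realType) (b : nat) (hb : (2 <= b)%N).
Local Notation Sigma := (symb R hb).
Context (d : measure_display) (Omega : measurableType d).
Variables (P : probability Omega R) (nu : probability Sigma R).
Variable X : seq 'I_b -> {RV P >-> R}.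
Hypothesis X_ge0 : forall u w, (0 <= X u w)%R.

Lemma integral_nu_1 n w : \int[nu_ X nu n w]_x (1%R)%:E = Zmass X nu n w.
Proof.
have QE : (fun x : Sigma => Qprod X n (w, x)) = (fun x => Yprod X [::] (restr x n) w).
  by apply/funext => x; exact: Qprod_restr.
have mq : measurable_fun setT (fun x : Sigma => Qprod X n (w, x)).
  by rewrite QE; exact: (measurable_fun_restr n (fun u => Yprod X [::] u w)).
have q0 (x : Sigma) : (0 <= Qprod X n (w, x))%R.
  by rewrite (congr1 (fun f => f x) QE) Yprod_ge0.
(* By unfolding, [nu_] is [mdensity], which carries a measure structure. *)
transitivity (\int[mdensity nu mq q0]_x (cst 1 x)) => //.
rewrite ge0_integral_mdensity// (Zmass_integral nu X_ge0).
by apply: eq_integral => x _; rewrite mul1e Qprod_restr.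
Qed.

(** Weak convergence is tested on the constant function 1. *)
Lemma ae_Qnu_mass (Qnu : R.-ker Omega ~> Sigma) : is_Qnu X P nu Qnu ->
  {ae P, forall w, Qnu w setT = Zlim X nu w}.
Proof.
have cont1 : continuous (cst 1%R : Sigma -> R) by exact: cst_continuous.
have bound1 : exists M : R, forall x : Sigma, (`|cst 1%R x| <= M)%R.
  by exists 1%R => x; rewrite /= normr1 lexx.
apply: filterS => w [_ /(_ _ cont1 bound1)].
under eq_fun do rewrite integral_nu_1.
have -> : \int[Qnu w]_x ((cst 1%R : Sigma -> R) x)%:E = Qnu w setT.
  transitivity (\int[Qnu w]_x cst 1 x) => //.
  by rewrite integral_cst// mul1e.
by move=> /cvg_limn_einf_sup[_ <-].
Qed.

Lemma singular_of_Zlim (Qnu : R.-ker Omega ~> Sigma) : is_Qnu X P nu Qnu ->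
  \int[P]_w Zlim X nu w = 0 -> Q_singular P Qnu.
Proof.
move=> HQ Z0; have : ae_eq P setT (Zlim X nu) (cst 0).
  apply/ae_eq_integral_abs => //; first exact: measurable_Zlim.
  by under eq_integral do rewrite gee0_abs ?Zlim_ge0//.
apply: filterS2 (ae_Qnu_mass HQ) => w QZ /(_ I) Zw B mB.
by apply/eqP; rewrite -measure_le0 -[leRHS]Zw -QZ le_measure ?inE.
Qed.

Lemma integral_Qnu_mass (Qnu : R.-ker Omega ~> Sigma) : is_Qnu X P nu Qnu ->
  \int[P]_w Qnu w setT = \int[P]_w Zlim X nu w.
Proof.
move=> HQ; apply: ge0_ae_eq_integral => //.
- exact: measurable_kernel.
- exact: measurable_Zlim.
- by move=> w _; exact: Zlim_ge0.
- by apply: filterS (ae_Qnu_mass HQ).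
Qed.

(** A measure is nonzero exactly when its total mass is; if the mass vanished almost surely, so
    would its integral. *)
Lemma nondegenerate_of_Zlim (Qnu : R.-ker Omega ~> Sigma) : is_Qnu X P nu Qnu ->
  0 < \int[P]_w Zlim X nu w -> Q_nondegenerate P Qnu.
Proof.
move=> HQ; rewrite -(integral_Qnu_mass HQ) => Qpos.
have mQ : measurable_fun setT (fun w => Qnu w setT) by exact: measurable_kernel.
rewrite /Q_nondegenerate (_ : [set w | _] = [set w | Qnu w setT != 0]); last first.
  apply/seteqP; split => [w [B mB]|w wQ]; last by exists setT.
  by rewrite /= -!measure_gt0 => /lt_le_trans; apply; rewrite le_measure ?inE.
have mN : measurable [set w | Qnu w setT != 0].
  by rewrite -[X in measurable X]setTI; exact: measurable_neqe.
rewrite measure_gt0; apply/eqP => N0; move: Qpos; apply/negP; rewrite -leNgt.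
rewrite (ge0_negligible_integral mN measurableT)//.
rewrite (eq_integral (cst 0)) ?integral0// => w.
by rewrite setTD inE => /= /negP; rewrite negbK => /eqP.
Qed.

End limit_measure.

(** * The criteria, deduced from the two inequalities *)

Unset Implicit Arguments.
Set Strict Implicit.
Set Printing Implicit Defensive.

Theorem theorem2p1 (R : realType) (b : nat) (hb : (2 <= b)%N)
  (d : measure_display) (Omega : measurableType d) (P : probability Omega R)
  (nu : probability (symb R hb) R)
  (X : seq 'I_b -> {RV P >-> R})
  (X_ge0 : forall u w, (0 <= X u w)%R)
  (X_nil : forall w, X [::] w = 1%R)
  (X_mart : forall u j, (1 <= size u)%N ->
    is_cond_exp P (F_gen X (size u)) (Yprod X [::] (rcons u j)) (Yprod X [::] u))
  (X_mean : forall j, 'E_P[X [:: j]] = 1)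
  (Pt Qt : probability (Otilde hb X) R)
  (HPt : is_Ptilde P nu Pt) (HQt : is_Qtilde Pt Qt) :
  [/\ 0 < Qt [set p | Lsup X nu p = +oo] -> \int[P]_w Zlim X nu w < 1,
      Qt [set p | Lsup X nu p = +oo] = 1 ->
        \int[P]_w Zlim X nu w = 0 /\
        (forall Qnu, is_Qnu X P nu Qnu -> Q_singular P Qnu) &
      (forall (x : symb R hb) (k : nat) (j : 'I_b) (u : seq 'I_b), j != x k ->
        is_cond_exp P (H_gen X x) (Yprod X (restr x k) (j :: u)) (cst 1%R)) ->
      (0 < Qt [set p | Ssum X nu p < +oo] ->
        0 < \int[P]_w Zlim X nu w /\
        (forall Qnu, is_Qnu X P nu Qnu -> Q_nondegenerate P Qnu)) /\
      (Qt [set p | Ssum X nu p < +oo] = 1 ->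
        \int[P]_w Zlim X nu w = 1 /\
        (forall Qnu, is_Qnu X P nu Qnu -> Q_regular P Qnu))].
Proof.
have LZ := Lsup_infty_Zlim X_ge0 X_mart X_mean HPt HQt.
have Z0 : 0 <= \int[P]_w Zlim X nu w.
  by apply: integral_ge0 => w _; exact: Zlim_ge0.
have Zle1 := integral_Zlim_le1 nu X_ge0 X_mart X_mean.
(* Finiteness of E(Z) allows it to be added to both sides of 0 < Qt(L = oo) with the inequality kept
   strict. *)
have Zfin : \int[P]_w Zlim X nu w \is a fin_num.
  by rewrite ge0_fin_numE// (le_lt_trans Zle1)// ltry.
split => [Qpos|Q1|X_spine].
- apply: lt_le_trans LZ; rewrite -[ltLHS]add0e.
  by rewrite lteD2rE.
- have {}Z0 : \int[P]_w Zlim X nu w = 0.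
    apply/eqP; rewrite eq_le Z0 andbT; move: LZ.
    by rewrite Q1 -[leRHS]adde0 leeD2lE.
  by split => // Qnu HQ; exact: (singular_of_Zlim X_ge0 HQ).
- have SZ := Ssum_finite_Zlim X_ge0 X_mart X_mean HPt HQt X_spine.
  split => [Qpos|Q1].
    have Zpos : 0 < \int[P]_w Zlim X nu w by exact: lt_le_trans SZ.
    by split => // Qnu HQ; exact: (nondegenerate_of_Zlim X_ge0 HQ).
  have Z1 : \int[P]_w Zlim X nu w = 1 by apply/eqP; rewrite eq_le Zle1 -Q1.
  by split => // Qnu HQ; rewrite /Q_regular (integral_Qnu_mass X_ge0 HQ).
Qed.
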